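(* Let $q$ be a complex number with $|q|<1$ and let $z$ be a nonzero complex number such that no denominator below vanishes. Then \begin{align*} \sum_{k=-\infty}^\infty\frac{q^{k^2}}{(zq;q)_k}z^{2k} ={}&\frac{(1/z;q)_\infty}{(1/z^2,z^2q;q)_\infty}(q^5;q^5)_\infty \left[(z^5q^3,z^{-5}q^2;q^5)_\infty+z^{-1}(z^5q^2,z^{-5}q^3;q^5)_\infty\right],\\ \sum_{k=-\infty}^\infty\frac{q^{k(k+1)}}{(zq;q)_k}z^{2k} ={}&\frac{(1/z;q)_\infty}{(1/z^2,z^2q;q)_\infty}(q^5;q^5)_\infty \left[(z^5q^4,z^{-5}q;q^5)_\infty+z^{-3}(z^5q,z^{-5}q^4;q^5)_\infty\right]. \end{align*}
   Context: For complex $a$ and $k\in\mathbb Z\cup\{\infty\}$ the $q$-shifted factorial is $(a;q)_0=1$, $(a;q)_k=\prod_{j=1}^k(1-aq^{j-1})$ for $k>0$ (including $k=\infty$, an infinite product), and $(a;q)_k=\prod_{j=1}^{-k}(1-aq^{-j})^{-1}$ for $k<0$. Also $(a_1,\dots,a_m;q)_k=(a_1;q)_k\cdots(a_m;q)_k$. *)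

(* Defs.v *)
From mathcomp Require Import all_boot all_order all_algebra.
From mathcomp Require Import complex.
From mathcomp Require Import all_classical all_reals all_analysis.

Set Implicit Arguments.
Unset Strict Implicit.
Unset Printing Implicit Defensive.

Import GRing.Theory Num.Theory numFieldNormedType.Exports.

Local Open Scope classical_set_scope.
Local Open Scope ring_scope.

(* The definitions are over an arbitrary [numFieldType] because the library
   puts the norm topology on abstract number fields, but not directly on the
   concrete type [R[i]]. *)

(* (a; q)_k for k : int; [Negz n] is the integer -(n + 1).  When k < 0, the
   value is 0 as soon as one of the factors 1 - a q^(-j) vanishes, since
   0^-1 = 0; hence [qpoch a q k != 0] says, for q != 0, that (a; q)_k is
   well defined and nonzero. *)
Definition qpoch (C : numFieldType) (a q : C) (k : int) : C :=
  match k with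
  | Posz n => \prod_(1 <= j < n.+1) (1 - a * q ^+ j.-1)
  | Negz n => \prod_(1 <= j < n.+2) (1 - a * q ^- j)^-1
  end.

Definition qpoch_inf (C : numFieldType) (a q : C) : C :=
  lim ((fun n : nat => qpoch a q n%:Z) @ \oo).

(* (a_1, ..., a_m; q)_oo *)
Definition qpochs_inf (C : numFieldType) (s : seq C) (q : C) : C :=
  \prod_(a <- s) qpoch_inf a q.

(* The bilateral series of f converges to l when both of its unilateral
   halves, over k >= 0 and over k < 0, converge and their sums add up to l. *)
Definition bilateral_sum_to (C : numFieldType) (f : int -> C) (l : C) : Prop :=
  exists l1 l2 : C,
    [/\ series (fun n : nat => f n%:Z) @ \oo --> l1,
        series (fun n : nat => f (- n.+1%:Z)) @ \oo --> l2
      & l = l1 + l2].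

(* Main.v *)
Require Import Defs.
From mathcomp Require Import all_boot all_order all_algebra.
From mathcomp Require Import complex.
From mathcomp Require Import all_classical all_reals all_analysis.
From mathcomp Require Import ring zify.

(** Write y = 1/z, (x)_n = (x; q)_n and theta(x) = (x)_oo (q/x)_oo, and let d = 0 or 1
    according to the identity.  Two summations are combined:
    - a well-poised sum expressing 1/(Y)_oo as
        sum_(s >= 0) h(Y q^s) Y^s q^(s^2 - d s) / ((q)_s (Y^2 q^(s - d))_oo),
      where h(Y) = 1 + Y for d = 0 and h(Y) = 1 - Y^2/q for d = 1; it follows from a
      telescoping relation between the sums at Y and Y q, iterated until Y q^n -> 0;
    - Cauchy's sum  sum_(s >= 0) q^(s^2) A^s (A q^(s + 1))_oo / (q)_s = 1.
    The first one, taken at Y = y q^(-k), turns the bilateral series into a double series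
    over (k, s) in which (zq)_k no longer occurs.  After the substitution r = k - s the
    inner sum over s is Cauchy's sum with A = z^2 q^(2 r + d), and what is left is
      (y)_oo / theta(y^2 q^(-d))
        * sum_r (-1)^r z^(5 r) q^((5 r^2 + r)/2 + 3 d r) h(y q^(-r)),
    which is a sum of two theta series in base q^5, evaluated by Jacobi's triple product. *)

Set Implicit Arguments.
Unset Strict Implicit.
Unset Printing Implicit Defensive.

Import Order.TTheory GRing.Theory Num.Theory numFieldNormedType.Exports.

Local Open Scope classical_set_scope.
Local Open Scope ring_scope.

(* The only form of completeness that is used; it also yields r ^+ n --> 0. *)
Definition geometrically_complete (C : numFieldType) : Prop :=
  forall (u : nat -> C) (M r : C), 0 <= r -> r < 1 ->
    (forall n, `|u n| <= M * r ^+ n) -> cvgn (series u).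

(** * Limits of sequences and geometrically dominated series *)

Section DominatedSeries.
Variable C : numFieldType.
Implicit Types (u v : nat -> C) (l M r : C).

Lemma cvgn_unique u l l' : u @ \oo --> l -> u @ \oo --> l' -> l = l'.
Proof. by move=> ul ul'; apply: (cvg_unique (@norm_hausdorff _ _) ul ul'). Qed.

Lemma eq_cvgn u v l : (forall n, u n = v n) -> v @ \oo --> l -> u @ \oo --> l.
Proof. by move=> /funext ->. Qed.

Lemma cvgn_shift u l : (u n.+1 @[n --> \oo] --> l) -> u @ \oo --> l.
Proof. by move=> h; rewrite -(cvg_shiftS u). Qed.

Lemma cvgn_comp u l (g : nat -> nat) :
  (forall n, (n <= g n)%N) -> u @ \oo --> l -> (u (g n) @[n --> \oo] --> l).
Proof.
move=> gn ul; apply: (cvg_comp _ _ _ ul).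
move=> P [N _ NP]; exists N => // n /= Nn; apply: NP => /=.
exact: leq_trans (gn n).
Qed.

Lemma norm_lim_le u l M : (forall n, `|u n| <= M) -> u @ \oo --> l -> `|l| <= M.
Proof.
move=> uM /cvgrPdist_lt ul.
have M0 : 0 <= M by apply: le_trans (uM 0%N).
(* The order of a [numFieldType] is partial; [<=] may be negated here because both sides are
   real. *)
rewrite real_leNgt ?normr_real ?ger0_real //; apply/negP => Ml.
have /ul [N _ /(_ N (leqnn N)) /= h] : 0 < `|l| - M by rewrite subr_gt0.
have : `|l| < `|l|.
  rewrite -{1}(subrK (u N) l); apply: le_lt_trans (ler_normD _ _) _.
  by have := ltr_leD h (uM N); rewrite subrK.
by rewrite ltxx.
Qed.

Lemma sum_geometric_le M r n : 0 <= M -> 0 <= r -> r < 1 ->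
  \sum_(0 <= k < n) M * r ^+ k <= M / (1 - r).
Proof.
move=> M0 r0 r1; rewrite -mulr_sumr ler_wpM2l //.
have r1' : 0 < 1 - r by rewrite subr_gt0.
rewrite -[leRHS]mul1r ler_pdivlMr // big_mkord.
have -> : (\sum_(i < n) r ^+ i) * (1 - r) = 1 - r ^+ n.
  by rewrite mulrC -[1 - r]opprB mulNr -subrX1 opprB.
by rewrite gerBl exprn_ge0.
Qed.

Lemma norm_sum_geometric_le u M r n : 0 <= r -> r < 1 ->
  (forall n, `|u n| <= M * r ^+ n) -> `|series u n| <= M / (1 - r).
Proof.
move=> r0 r1 uM; apply: (@le_trans _ _ (\sum_(0 <= k < n) M * r ^+ k)).
  by apply: le_trans (ler_norm_sum _ _ _) _; apply: ler_sum.
apply: sum_geometric_le => //.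
by have := uM 0%N; rewrite expr0 mulr1; exact: le_trans.
Qed.

(** The tail after n terms is itself a dominated series, with constant M r^n in place of M. *)
Lemma series_tail_le u l M r n : 0 <= r -> r < 1 ->
  (forall n, `|u n| <= M * r ^+ n) -> series u @ \oo --> l ->
  `|l - series u n| <= M * r ^+ n / (1 - r).
Proof.
move=> r0 r1 uM ul.
have tailE k : series (fun k => u (k + n)%N) k = series u (k + n)%N - series u n.
  rewrite /series /= (big_cat_nat _ (n := n) (p := (k + n)%N)) ?leq_addl //=.
  rewrite [X in _ = X - _]addrC addrK.
  by rewrite -{2}[n]add0n big_addn addnK.
apply: (@norm_lim_le (series (fun k => u (k + n)%N))).
  move=> k; apply: norm_sum_geometric_le => // j.
  by rewrite -mulrA -exprD addnC.
apply: (eq_cvgn tailE).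
apply: cvgB; last exact: cvg_cst.
by apply: (cvgn_comp (g := addn^~ n)) ul => k; rewrite leq_addr.
Qed.

Lemma cvg_seriesD u v l l' : series u @ \oo --> l -> series v @ \oo --> l' ->
  series (fun n => u n + v n) @ \oo --> l + l'.
Proof.
move=> ul vl; apply: eq_cvgn (cvgD ul vl) => n.
by rewrite /series /= big_split.
Qed.

Lemma cvg_seriesZ c u l : series u @ \oo --> l ->
  series (fun n => c * u n) @ \oo --> c * l.
Proof.
move=> ul; apply: eq_cvgn (cvgMl_tmp (a := c) ul) => n.
by rewrite /series /= -mulr_sumr.
Qed.

Lemma cvg_series_sum m (f : nat -> nat -> C) (l : nat -> C) :
  (forall i, series (f i) @ \oo --> l i) ->
  series (fun n => series (fun i => f i n) m) @ \oo --> series l m.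
Proof.
move=> fl; elim: m => [|m IH].
  apply: (@eq_cvgn _ (fun=> 0)); last by rewrite /series /= big_nil; exact: cvg_cst.
  by move=> n; rewrite /series /= big1 // => i _; rewrite big_nil.
have -> : (fun n => series (fun i => f i n) m.+1) =
    (fun n => series (fun i => f i n) m + f m n).
  by apply/funext => n; rewrite /series /= big_nat_recr.
by rewrite /series /= big_nat_recr //; apply: cvg_seriesD.
Qed.

Lemma cvg_finite_sum m (f : nat -> nat -> C) (l : nat -> C) :
  (forall i, f^~ i @ \oo --> l i) ->
  (series (f n) m @[n --> \oo] --> series l m).
Proof.
move=> fl; elim: m => [|m IH].
  apply: (@eq_cvgn _ (fun=> 0)); last by rewrite /series /= big_nil; exact: cvg_cst.
  by move=> n; rewrite /series /= big_nil.
rewrite /series /= big_nat_recr //=.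
by apply: eq_cvgn (cvgD IH (fl m)) => n; rewrite /= big_nat_recr.
Qed.

Hypothesis geoC : geometrically_complete C.

(** A [numFieldType] need not be Archimedean, so this rests on completeness: r^n is the difference
    of two consecutive partial sums of a convergent geometric series. *)
Lemma cvg_expr0 r : 0 <= r -> r < 1 -> r ^+ n @[n --> \oo] --> 0.
Proof.
move=> r0 r1.
have /cvg_ex[/= l ul] : cvgn (series (fun n => r ^+ n)).
  by apply: (geoC (M := 1) r0 r1) => n; rewrite mul1r ger0_norm ?exprn_ge0.
have ul1 : series (fun n => r ^+ n) n.+1 @[n --> \oo] --> l.
  by apply: (cvgn_comp (g := S)) ul => n; exact: leqnSn.
rewrite -(subrr l); apply: (eq_cvgn _ (cvgB ul1 ul)) => n.
change (r ^+ n = \sum_(0 <= k < n.+1) r ^+ k - \sum_(0 <= k < n) r ^+ k).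
by rewrite big_nat_recr //= addrAC subrr add0r.
Qed.

Lemma exists_expr_small M r e : 0 <= M -> 0 <= r -> r < 1 -> 0 < e ->
  exists n, M * r ^+ n < e.
Proof.
move=> M0 r0 r1 e0.
have /cvgrPdist_lt h : M * r ^+ n @[n --> \oo] --> 0.
  by rewrite -(mulr0 M); exact: cvgMl_tmp (cvg_expr0 r0 r1).
have [N _ /(_ N (leqnn N)) /=] := h e e0.
rewrite sub0r normrN ger0_norm ?mulr_ge0 ?exprn_ge0 // => hN.
by exists N.
Qed.

(* Tannery's theorem for a geometric majorant. *)
Lemma cvg_dominated_series (a : nat -> nat -> C) (b A : nat -> C) (B M r : C) :
  0 <= r -> r < 1 -> (forall n s, `|a n s| <= M * r ^+ s) ->
  (forall s, a^~ s @ \oo --> b s) ->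
  (forall n, series (a n) @ \oo --> A n) -> series b @ \oo --> B ->
  A @ \oo --> B.
Proof.
move=> r0 r1 aM ab aA bB.
have bM s : `|b s| <= M * r ^+ s by apply: (norm_lim_le (u := a^~ s)).
have M0 : 0 <= M by have := bM 0%N; rewrite expr0 mulr1; exact: le_trans.
have r1' : 0 < 1 - r by rewrite subr_gt0.
apply/cvgrPdist_lt => e e0.
have e3 : 0 < e / 3 by rewrite divr_gt0.
(* K is the cut: beyond it the tails of [b] and of every [a n] are below e/3, uniformly in n. The
   first K terms form a finite sum, which converges termwise. *)
have [K hK] := exists_expr_small (divr_ge0 M0 (ltW r1')) r0 r1 e3.
have {}hK : M * r ^+ K / (1 - r) < e / 3 by rewrite mulrAC.
have /cvgrPdist_lt hb := cvg_finite_sum (m := K) ab.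
apply: filterS (hb _ e3) => n /= h.
have -> : B - A n = (B - series b K) + (series b K - series (a n) K)
                    + - (A n - series (a n) K) by ring.
apply: le_lt_trans (ler_normD _ _) _; rewrite normrN.
have -> : e = e / 3 + e / 3 + e / 3 by field.
apply: ltr_leD; last first.
  by apply: le_trans (ltW hK); apply: series_tail_le.
apply: le_lt_trans (ler_normD _ _) _; apply: ler_ltD => //.
by apply: le_trans (ltW hK); apply: series_tail_le.
Qed.

End DominatedSeries.

(** * Bilateral series and rearrangement of double series *)

Section Bilateral.
Variable C : numFieldType.
Implicit Types (f g : int -> C) (l M r : C).

(** The range of summation is -n <= k < n. One sequence replaces the two halves, so that results on
    sequences apply to bilateral sums. *)
Definition bilateral_partial f (n : nat) : C :=
  series (fun i : nat => f i%:Z) n + series (fun i : nat => f (- i.+1%:Z)) n.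

Lemma bilateral_sum_cvg f l :
  bilateral_sum_to f l -> bilateral_partial f @ \oo --> l.
Proof. by move=> [l1 [l2 [h1 h2 ->]]]; exact: cvgD. Qed.

Lemma bilateral_sum_unique f l l' :
  bilateral_sum_to f l -> bilateral_sum_to f l' -> l = l'.
Proof. move=> /bilateral_sum_cvg h /bilateral_sum_cvg; exact: cvgn_unique. Qed.

Lemma eq_bilateral_sum f g l : (forall k, f k = g k) ->
  bilateral_sum_to f l -> bilateral_sum_to g l.
Proof. by move=> /funext ->. Qed.

Lemma bilateral_sumD f g l l' : bilateral_sum_to f l -> bilateral_sum_to g l' ->
  bilateral_sum_to (fun k => f k + g k) (l + l').
Proof.
move=> [l1 [l2 [h1 h2 ->]]] [l3 [l4 [h3 h4 ->]]].
by exists (l1 + l3), (l2 + l4); split; [exact: cvg_seriesD..|ring].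
Qed.

Lemma bilateral_sumZ c f l : bilateral_sum_to f l ->
  bilateral_sum_to (fun k => c * f k) (c * l).
Proof.
move=> [l1 [l2 [h1 h2 ->]]].
by exists (c * l1), (c * l2); split; [exact: cvg_seriesZ..|ring].
Qed.

(** The shift moves the single term f(-1) from the negative half to the nonnegative one. *)
Lemma bilateral_sum_pred f l : bilateral_sum_to f l ->
  bilateral_sum_to (fun k => f (k - 1)) l.
Proof.
move=> [l1 [l2 [h1 h2 ->]]].
exists (f (-1) + l1), (l2 - f (-1)); split; last by ring.
  apply: cvgn_shift.
  have e n : series (fun i : nat => f (i%:Z - 1)) n.+1 =
      f (-1) + series (fun i : nat => f i%:Z) n.
    rewrite /series /= big_nat_recl //; congr (f _ + _).
    by apply: eq_bigr => i _; congr f; lia.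
  apply: (eq_cvgn e).
  by apply: cvgD => //; exact: cvg_cst.
have e n : series (fun i : nat => f (- i.+1%:Z - 1)) n =
    series (fun i : nat => f (- i.+1%:Z)) n.+1 - f (-1).
  rewrite /series /= big_nat_recl // addrC addKr.
  by apply: eq_bigr => i _; congr f; lia.
apply: (eq_cvgn e).
apply: cvgB; last exact: cvg_cst.
by rewrite (cvg_shiftS (series (fun i : nat => f (- i.+1%:Z)))).
Qed.

Lemma bilateral_sum_subn f l (s : nat) : bilateral_sum_to f l ->
  bilateral_sum_to (fun k => f (k - s%:Z)) l.
Proof.
move=> fl; elim: s => [|s IH].
  by apply: eq_bilateral_sum fl => k; rewrite subr0.
by apply: eq_bilateral_sum (bilateral_sum_pred IH) => k; congr f; lia.
Qed.

Hypothesis geoC : geometrically_complete C.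

Lemma bilateral_sum_dominated f M r : 0 <= r -> r < 1 ->
  (forall k, `|f k| <= M * r ^+ `|k|%N) -> exists l, bilateral_sum_to f l.
Proof.
move=> r0 r1 fM.
have M0 : 0 <= M by have := fM 0; rewrite expr0 mulr1; exact: le_trans.
have /cvg_ex[/= l1 h1] : cvgn (series (fun n : nat => f n%:Z)).
  by apply: (geoC r0 r1) => n; apply: fM.
have /cvg_ex[/= l2 h2] : cvgn (series (fun n : nat => f (- n.+1%:Z))).
  apply: (geoC (M := M * r) r0 r1) => n.
  by apply: le_trans (fM _) _; rewrite -mulrA -exprS abszN.
by exists (l1 + l2), l1, l2.
Qed.

Lemma norm_bilateral_partial_le f M r n : 0 <= r -> r < 1 ->
  (forall k, `|f k| <= M * r ^+ `|k|%N) ->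
  `|bilateral_partial f n| <= M / (1 - r) + M * r / (1 - r).
Proof.
move=> r0 r1 fM; apply: le_trans (ler_normD _ _) _; apply: lerD.
  by apply: norm_sum_geometric_le => // k; apply: fM.
apply: norm_sum_geometric_le => // k.
by apply: le_trans (fM _) _; rewrite -mulrA -exprS abszN.
Qed.

Lemma dominated_sum_le (u : nat -> C) l M r : 0 <= r -> r < 1 ->
  (forall n, `|u n| <= M * r ^+ n) -> series u @ \oo --> l ->
  `|l| <= M / (1 - r).
Proof.
move=> r0 r1 uM; apply: norm_lim_le => n; exact: norm_sum_geometric_le.
Qed.

(** Fubini for a geometric majorant. For fixed n the sum over -n <= k < n is finite and commutes
    with the sum over s; the partial column sums are bounded by K r^s uniformly in n, so Tannery's
    theorem allows n to tend to infinity. *)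
Lemma bilateral_sum_rows (T : int -> nat -> C) (A : int -> C) (L : nat -> C) M r :
  0 <= r -> r < 1 -> (forall k s, `|T k s| <= M * r ^+ (`|k| + s)%N) ->
  (forall k, series (T k) @ \oo --> A k) ->
  (forall s, bilateral_sum_to (T^~ s) (L s)) ->
  exists2 l, bilateral_sum_to A l & series L @ \oo --> l.
Proof.
move=> r0 r1 TM TA TL.
have M0 : 0 <= M by have := TM 0 0%N; rewrite expr0 mulr1; exact: le_trans.
have r1' : 0 < 1 - r by rewrite subr_gt0.
have TMs k s : `|T k s| <= M * r ^+ s * r ^+ `|k|%N.
  by rewrite -mulrA -exprD addnC.
have TMk k s : `|T k s| <= M * r ^+ `|k|%N * r ^+ s by rewrite -mulrA -exprD.
have AM k : `|A k| <= M / (1 - r) * r ^+ `|k|%N.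
  by rewrite mulrAC; apply: (dominated_sum_le r0 r1 (TMk k)).
have [l Al] := bilateral_sum_dominated r0 r1 AM.
exists l => //.
pose K := (1 + r) * M / (1 - r).
have pM n s : `|bilateral_partial (T^~ s) n| <= K * r ^+ s.
  have -> : K * r ^+ s = M * r ^+ s / (1 - r) + M * r ^+ s * r / (1 - r).
    by rewrite /K; ring.
  by apply: norm_bilateral_partial_le.
have Lp s : bilateral_partial (T^~ s) @ \oo --> L s by exact: bilateral_sum_cvg.
have LM s : `|L s| <= K * r ^+ s.
  exact: (norm_lim_le (fun n => pM n s) (Lp s)).
have /cvg_ex[/= l' Ll'] := geoC r0 r1 LM.
suff -> : l = l' by [].
apply: (cvgn_unique (bilateral_sum_cvg Al)).
apply: (cvg_dominated_series geoC r0 r1 pM Lp _ Ll') => n.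
rewrite /bilateral_partial.
by apply: cvg_seriesD; apply: cvg_series_sum.
Qed.

(** The shear k -> k - s translates each column and so preserves its sum; rows and diagonals
    therefore both add up to the sum of the column sums. The squared ratio pays for the shear, since
    |k| + s <= 2 (|k - s| + s). *)
Lemma bilateral_sum_exchange (T : int -> nat -> C) (A B : int -> C) M r l :
  0 <= r -> r < 1 -> (forall k s, `|T k s| <= M * (r ^+ 2) ^+ (`|k| + s)%N) ->
  (forall k, series (T k) @ \oo --> A k) ->
  (forall k : int, series (fun s : nat => T (k - s%:Z) s) @ \oo --> B k) ->
  bilateral_sum_to A l -> bilateral_sum_to B l.
Proof.
move=> r0 r1 TM TA TB Al.
have M0 : 0 <= M by have := TM 0 0%N; rewrite expr0 mulr1; exact: le_trans.
have TM' k s : `|T k s| <= M * r ^+ (`|k| + s)%N.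
  apply: le_trans (TM k s) _; rewrite -exprM ler_wpM2l //.
  by apply: ler_wiXn2l => //; [exact: ltW | lia].
have /choice[L TL] : forall s, exists l, bilateral_sum_to (T^~ s) l.
  move=> s; apply: (bilateral_sum_dominated (M := M * r ^+ s) r0 r1) => k.
  by rewrite -mulrA -exprD addnC.
have [l1 Al1 Ll1] := bilateral_sum_rows r0 r1 TM' TA TL.
have -> := bilateral_sum_unique Al Al1.
have TMB (k : int) (s : nat) : `|T (k - s%:Z) s| <= M * r ^+ (`|k| + s)%N.
  apply: le_trans (TM _ s) _; rewrite -exprM ler_wpM2l //.
  by apply: ler_wiXn2l => //; [exact: ltW | lia].
have [|l2 Bl2 Ll2] := @bilateral_sum_rows (fun k s => T (k - s%:Z) s) B L M r r0 r1 TMB TB.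
  by move=> s; exact: (bilateral_sum_subn (f := T^~ s)).
by rewrite (cvgn_unique Ll1 Ll2).
Qed.

End Bilateral.

(** * Infinite products and q-shifted factorials *)

Section InfiniteProducts.
Variable C : numFieldType.
Hypothesis geoC : geometrically_complete C.

(** For x_i >= 0 the product of the 1 + x_i times 1 minus the sum of the x_i is at most 1. From an
    index J on, the sum of the t r^i is at most 1/2, so the remaining product is at most 2. *)
Lemma prod_geometric_bounded (t r : C) : 0 <= t -> 0 <= r -> r < 1 ->
  exists2 K : C, 0 <= K & forall n, \prod_(0 <= i < n) (1 + t * r ^+ i) <= K.
Proof.
move=> t0 r0 r1.
have r1' : 0 < 1 - r by rewrite subr_gt0.
have f_ge1 i : 1 <= 1 + t * r ^+ i by rewrite lerDl mulr_ge0 ?exprn_ge0.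
have p_ge0 m n : 0 <= \prod_(m <= i < n) (1 + t * r ^+ i).
  by apply: prodr_ge0 => i _; apply: le_trans (f_ge1 i).
have [J hJ] : exists n, t / (1 - r) * r ^+ n < 2^-1.
  by apply: (exists_expr_small geoC (divr_ge0 t0 (ltW r1')) r0 r1); rewrite invr_gt0.
have {}hJ n : \sum_(0 <= i < n) t * r ^+ (i + J) <= 2^-1.
  apply: le_trans (ltW hJ); rewrite mulrAC.
  under eq_bigr do rewrite addnC exprD mulrA.
  by apply: sum_geometric_le => //; rewrite mulr_ge0 ?exprn_ge0.
have tail n : \prod_(0 <= i < n) (1 + t * r ^+ (i + J))
    * (1 - \sum_(0 <= i < n) t * r ^+ (i + J)) <= 1.
  elim: n => [|n IH]; first by rewrite !big_nil subr0 mulr1.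
  rewrite !big_nat_recr //=; set p := \prod_(_ <= _ < _) _ in IH *.
  set S := \sum_(_ <= _ < _) _ in IH *; set x := t * r ^+ (n + J).
  have x0 : 0 <= x by rewrite mulr_ge0 ?exprn_ge0.
  have S0 : 0 <= S by apply: sumr_ge0 => i _; rewrite mulr_ge0 ?exprn_ge0.
  have p0 : 0 <= p.
    by apply: prodr_ge0 => i _; apply: le_trans (f_ge1 _).
  apply: le_trans IH; rewrite -mulrA ler_wpM2l // -subr_ge0.
  have -> : 1 - S - (1 + x) * (1 - (S + x)) = x * S + x * x by ring.
  by apply: addr_ge0; apply: mulr_ge0.
exists (\prod_(0 <= i < J) (1 + t * r ^+ i) * 2); first by rewrite mulr_ge0.
move=> n; apply: (@le_trans _ _ (\prod_(0 <= i < n + J) (1 + t * r ^+ i))).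
  rewrite (big_cat_nat _ (n := n) (p := (n + J)%N)) ?leq_addr //= ler_peMr //.
  by elim/big_ind: _ => // x y x1 y1; exact: mulr_ege1.
rewrite (big_cat_nat _ (n := J) (p := (n + J)%N)) ?leq_addl //= ler_wpM2l //.
rewrite -{1}[J]add0n big_addn addnK.
have := tail n; set p := \prod_(_ <= _ < _) _ => h.
have p0 : 0 <= p by apply: prodr_ge0 => i _; apply: le_trans (f_ge1 _).
rewrite -[2]mul1r -ler_pdivrMr //.
apply: le_trans h; rewrite ler_wpM2l // lerBrDr.
apply: (@le_trans _ _ (2^-1 + 2^-1)); first by rewrite lerD2l.
by rewrite (_ : 2^-1 + 2^-1 = 1 :> C) //; field.
Qed.

Lemma norm_prod1D_le (u : nat -> C) (t r : C) n : (forall i, `|u i| <= t * r ^+ i) ->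
  `|\prod_(0 <= i < n) (1 + u i)| <= \prod_(0 <= i < n) (1 + t * r ^+ i).
Proof.
move=> ut; rewrite normr_prod; apply: ler_prod => i _; rewrite normr_ge0 /=.
by apply: le_trans (ler_normD _ _) _; rewrite normr1 lerD2l.
Qed.

(** Consecutive partial products differ by p n u n. As the p n are bounded, the product is 1 plus a
    dominated series. *)
Lemma cvg_prod1D (u : nat -> C) (t r : C) : 0 <= r -> r < 1 ->
  (forall i, `|u i| <= t * r ^+ i) ->
  exists l : C, \prod_(0 <= i < n) (1 + u i) @[n --> \oo] --> l.
Proof.
move=> r0 r1 ut.
have t0 : 0 <= t by have := ut 0%N; rewrite expr0 mulr1; exact: le_trans.
have [K K0 hK] := prod_geometric_bounded t0 r0 r1.
pose p n := \prod_(0 <= i < n) (1 + u i).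
have /cvg_ex[/= l hl] : cvgn (series (fun n => p n * u n)).
  apply: (geoC (M := K * t) r0 r1) => n; rewrite normrM -mulrA.
  by apply: ler_pM => //; apply: le_trans (hK n); apply: norm_prod1D_le.
have c1 : (fun=> 1 : C) @ \oo --> (1 : C) by exact: cvg_cst.
exists (1 + l); apply: (eq_cvgn _ (cvgD c1 hl)) => n.
change (p n = 1 + \sum_(0 <= i < n) p i * u i).
elim: n => [|n IH]; first by rewrite /p !big_nil addr0.
by rewrite big_nat_recr //= addrA -IH /p big_nat_recr //=; ring.
Qed.

Definition qfac (x q : C) (n : nat) : C := \prod_(0 <= i < n) (1 - x * q ^+ i).

Lemma qpoch_natE x q (n : nat) : qpoch x q n%:Z = qfac x q n.
Proof. by rewrite /qpoch /qfac big_add1. Qed.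

Lemma qfac0 x q : qfac x q 0 = 1.
Proof. by rewrite /qfac big_nil. Qed.

Lemma qfacSr x q n : qfac x q n.+1 = qfac x q n * (1 - x * q ^+ n).
Proof. by rewrite /qfac big_nat_recr. Qed.

Lemma qfacSl x q n : qfac x q n.+1 = (1 - x) * qfac (x * q) q n.
Proof.
rewrite /qfac big_nat_recl //= expr0 mulr1; congr (_ * _).
by apply: eq_bigr => i _; rewrite exprS mulrA.
Qed.

Lemma qfacD x q m n : qfac x q (m + n) = qfac x q m * qfac (x * q ^+ m) q n.
Proof.
elim: n => [|n IH]; first by rewrite addn0 qfac0 mulr1.
by rewrite addnS !qfacSr IH exprD; ring.
Qed.

Section Base.
Variable q : C.
Hypothesis q_lt1 : `|q| < 1.

Lemma cvg_qfac x : qfac x q @ \oo --> qpoch_inf x q.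
Proof.
have [] := @cvg_prod1D (fun i => - x * q ^+ i) `|x| `|q|; rewrite ?normr_ge0 //.
  by move=> i; rewrite normrM normrN normrX.
move=> l hl; have {}hl : qfac x q @ \oo --> l.
  by apply: (eq_cvgn _ hl) => n; apply: eq_bigr => i _; rewrite mulNr.
suff -> : qpoch_inf x q = l by [].
rewrite /qpoch_inf; apply: (cvg_lim (@norm_hausdorff _ _)).
by apply: (eq_cvgn _ hl) => n; rewrite qpoch_natE.
Qed.

Lemma qfac_bounded (X : C) : 0 <= X ->
  exists2 K : C, 0 <= K & forall x n, `|x| <= X -> `|qfac x q n| <= K.
Proof.
move=> X0; have [K K0 hK] := prod_geometric_bounded X0 (normr_ge0 q) q_lt1.
exists K => // x n xX; apply: le_trans (hK n).
rewrite (_ : qfac x q n = \prod_(0 <= i < n) (1 + - (x * q ^+ i))) //.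
by apply: norm_prod1D_le => i; rewrite normrN normrM normrX ler_wpM2r ?exprn_ge0.
Qed.

Lemma qpoch_inf_bounded (X : C) : 0 <= X ->
  exists2 K : C, 0 <= K & forall x, `|x| <= X -> `|qpoch_inf x q| <= K.
Proof.
move=> /qfac_bounded[K K0 hK]; exists K => // x xX.
exact: (norm_lim_le (fun n => hK x n xX) (@cvg_qfac x)).
Qed.

Lemma expr_cvg0 (x : C) : `|x| < 1 -> x ^+ n @[n --> \oo] --> 0.
Proof.
move=> x1; apply/cvgr0Pnorm_lt => e e0.
have /cvgr0Pnorm_lt h := cvg_expr0 geoC (normr_ge0 x) x1.
by apply: filterS (h e e0) => n /=; rewrite !normrX normr_id.
Qed.

Lemma qfac_qq_neq0 n : qfac q q n != 0.
Proof.
rewrite /qfac prodf_seq_neq0; apply/allP => i _ /=.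
rewrite -exprS subr_eq0 eq_sym; apply/eqP => h.
have : `|q ^+ i.+1| < 1 by rewrite normrX exprn_ilt1.
by rewrite h normr1 ltxx.
Qed.

(** Since 1/(1 - q^(i+1)) = 1 + q^(i+1)/(1 - q^(i+1)), the inverse is again a product covered by the
    two preceding results on products. The constant uses |1 - q^(i+1)| >= 1 - |q|. *)
Lemma qfac_inv_cvg : exists2 K : C, 0 <= K & (forall n, `|(qfac q q n)^-1| <= K) /\
  (exists l : C, (qfac q q n)^-1 @[n --> \oo] --> l).
Proof.
have q1' : 0 < 1 - `|q| by rewrite subr_gt0.
pose u i := q ^+ i.+1 / (1 - q ^+ i.+1).
have qi i : 1 - `|q| <= `|1 - q ^+ i.+1|.
  apply: le_trans (lerB_dist _ _); rewrite normr1 lerD2l lerN2 normrX exprS.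
  by rewrite ler_piMr // exprn_ile1 // ltW.
have nz i : 1 - q ^+ i.+1 != 0.
  by rewrite -normr_gt0; apply: lt_le_trans (qi i).
have ut i : `|u i| <= `|q| / (1 - `|q|) * `|q| ^+ i.
  rewrite /u normrM normfV normrX exprS [leRHS]mulrAC.
  by rewrite ler_wpM2l ?mulr_ge0 ?exprn_ge0 // lef_pV2 ?posrE // normr_gt0.
have e n : (qfac q q n)^-1 = \prod_(0 <= i < n) (1 + u i).
  rewrite /qfac -prodfV; apply: eq_bigr => i _.
  by rewrite -exprS /u; field; exact: nz.
have t0 : 0 <= `|q| / (1 - `|q|) by rewrite divr_ge0 // ltW.
have [K K0 hK] := prod_geometric_bounded t0 (normr_ge0 q) q_lt1.
exists K => //; split.
  by move=> n; rewrite e; apply: le_trans (hK n); apply: norm_prod1D_le.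
have [l hl] := cvg_prod1D (normr_ge0 q) q_lt1 ut.
by exists l; apply: (eq_cvgn e).
Qed.

Lemma qfac_inv_bounded :
  exists2 K : C, 0 <= K & forall n, `|(qfac q q n)^-1| <= K.
Proof. by have [K K0 [hK _]] := qfac_inv_cvg; exists K. Qed.

(** The inverses of the partial products converge too, and the product of the two limits is 1. *)
Lemma qpoch_inf_qq_neq0 : qpoch_inf q q != 0.
Proof.
have [_ _ [_ [l hl]]] := qfac_inv_cvg.
have h1 : (fun=> 1 : C) @ \oo --> qpoch_inf q q * l.
  apply: (eq_cvgn _ (cvgM (@cvg_qfac q) hl)) => n /=.
  by rewrite mulfV // qfac_qq_neq0.
have c1 : (fun=> 1 : C) @ \oo --> (1 : C) by exact: cvg_cst.
have /eqP := cvgn_unique c1 h1.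
by apply: contraTneq => ->; rewrite mul0r oner_eq0.
Qed.

Lemma qpoch_infD x n : qpoch_inf x q = qfac x q n * qpoch_inf (x * q ^+ n) q.
Proof.
have h : qfac x q (n + m)%N @[m --> \oo] --> qpoch_inf x q.
  by apply: (cvgn_comp (g := addn n)) (@cvg_qfac x) => m; exact: leq_addl.
apply: (cvgn_unique h).
apply: (eq_cvgn _ (cvgMl_tmp (a := qfac x q n) (@cvg_qfac (x * q ^+ n)))) => m.
exact: qfacD.
Qed.

Lemma qpoch_infS x : qpoch_inf x q = (1 - x) * qpoch_inf (x * q) q.
Proof. by rewrite (qpoch_infD x 1) qfacSl qfac0 mulr1 expr1. Qed.

(** The product of the 4 E |q|^i over i < n equals |q|^C(n,2) (4 E)^n and is at most the bounded
    product of the 1 + 4 E |q|^i. The ratio 1/4 is written as a square to fit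
    [bilateral_sum_exchange]. *)
Lemma gaussian_le (E : C) : 0 <= E ->
  exists2 M : C, 0 <= M & forall n, `|q| ^+ 'C(n, 2) * E ^+ n <= M * (2^-1 ^+ 2) ^+ n.
Proof.
move=> E0; have E40 : 0 <= E * 4 by rewrite mulr_ge0.
have [K K0 hK] := prod_geometric_bounded E40 (normr_ge0 q) q_lt1.
exists K => // n.
have -> : (2^-1 ^+ 2 : C) = 4^-1 by field.
rewrite exprVn ler_pdivlMr ?exprn_gt0 //; apply: le_trans (hK n).
rewrite -mulrA -exprMn.
have -> : `|q| ^+ 'C(n, 2) * (E * 4) ^+ n = \prod_(0 <= i < n) (E * 4 * `|q| ^+ i).
  elim: n => [|n IH]; first by rewrite big_nil !expr0 mulr1.
  by rewrite big_nat_recr //= -IH binS bin1 exprD exprS; ring.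
rewrite big_seq [leRHS]big_seq.
apply: ler_prod => i _; rewrite mulr_ge0 ?exprn_ge0 //= lerDr ler01 //.
Qed.

End Base.
End InfiniteProducts.

(** * The two well-poised summations *)

Section WellPoised.
Variable C : numFieldType.
Hypothesis geoC : geometrically_complete C.
Variable q : C.
Hypothesis q_lt1 : `|q| < 1.
Let r : C := 2^-1 ^+ 2.
Let r0 : 0 <= r. Proof. by rewrite exprn_ge0 // invr_ge0. Qed.
Let r1 : r < 1.
Proof. by rewrite exprn_ilt1 ?invr_ge0 ?invf_lt1 ?ltr1n. Qed.

(** Source of the majorants for the unilateral series below: M depends on X only, so the bound is
    uniform over the disk |x| <= X and over the bounded coefficients c. *)
Lemma gaussian_dominated (X : C) : 0 <= X ->
  exists2 M : C, 0 <= M & forall (x c K : C) (s e : nat),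
    `|x| <= X -> ('C(s, 2) <= e)%N -> `|c| <= K ->
    `|c * (x ^+ s * q ^+ e)| <= K * M * (2^-1 ^+ 2) ^+ s.
Proof.
move=> X0; have [M M0 hM] := gaussian_le geoC q_lt1 X0.
exists M => // x c K s e xX se cK; rewrite !normrM !normrX -mulrA.
apply: ler_pM; rewrite ?mulr_ge0 ?exprn_ge0 //.
apply: le_trans (hM s); rewrite mulrC.
apply: ler_pM; rewrite ?exprn_ge0 //; last by apply: lerXn2r; rewrite ?nnegrE.
by apply: ler_wiXn2l => //; exact: ltW.
Qed.

Lemma dominated_cvg0 (u : nat -> C) (M t : C) : 0 <= t -> t < 1 ->
  (forall n, `|u n| <= M * t ^+ n) -> u @ \oo --> 0.
Proof.
move=> t0 t1 uM.
have M0 : 0 <= M by have := uM 0%N; rewrite expr0 mulr1; exact: le_trans.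
apply/cvgr0Pnorm_lt => e e0.
have /cvgr0Pnorm_lt h : M * t ^+ n @[n --> \oo] --> 0.
  by rewrite -(mulr0 M); exact: cvgMl_tmp (cvg_expr0 geoC t0 t1).
apply: filterS (h e e0) => n /=; rewrite ger0_norm ?mulr_ge0 ?exprn_ge0 //.
exact: le_lt_trans.
Qed.

Lemma cvgn_exp (w : nat -> C) (l : C) m : w @ \oo --> l ->
  w n ^+ m @[n --> \oo] --> l ^+ m.
Proof.
move=> wl; elim: m => [|m IH].
  by apply: (@eq_cvgn _ _ (fun=> 1)); [|exact: cvg_cst].
by rewrite exprS; apply: (eq_cvgn _ (cvgM wl IH)) => n; rewrite exprS.
Qed.

Lemma cvgn_qfac (w : nat -> C) (l : C) m : w @ \oo --> l ->
  qfac (w n) q m @[n --> \oo] --> qfac l q m.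
Proof.
move=> wl; elim: m => [|m IH].
  rewrite qfac0; apply: (@eq_cvgn _ _ (fun=> 1)); last exact: cvg_cst.
  by move=> n; rewrite qfac0.
rewrite qfacSr; apply: (@eq_cvgn _ _ (fun n => qfac (w n) q m * (1 - w n * q ^+ m))).
  by move=> n; rewrite qfacSr.
apply: cvgM IH _; apply: cvgB; first exact: cvg_cst.
exact: cvgMr_tmp.
Qed.

(** Iterating the recurrence gives (Y)_n F(Y) = (Y^2 v)_(2n) F(Y q^n). As Y q^n tends to 0,
    Tannery's theorem yields F(Y q^n) --> F(0) = 1. The values v = 1 and v = 1/q serve the two
    identities. *)
Lemma geometric_iteration (a : C -> nat -> C) (v : C) :
  (forall X, 0 <= X -> exists M : C, forall Y s, `|Y| <= X ->
     `|a Y s| <= M * (2^-1 ^+ 2) ^+ s) ->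
  (forall (w : nat -> C) s, w @ \oo --> 0 -> a (w n) s @[n --> \oo] --> a 0 s) ->
  (forall s, a 0 s = (s == 0%N)%:R) ->
  (forall Y F F' : C, series (a Y) @ \oo --> F -> series (a (Y * q)) @ \oo --> F' ->
     (1 - Y) * F = (1 - Y ^+ 2 * v) * (1 - Y ^+ 2 * v * q) * F') ->
  forall Y, exists2 l : C, series (a Y) @ \oo --> l &
    l * qpoch_inf Y q = qpoch_inf (Y ^+ 2 * v) q.
Proof.
move=> aM acont a0 arec.
have /choice[F aF] : forall Y, exists l : C, series (a Y) @ \oo --> l.
  move=> Y; have [M hM] := aM `|Y| (normr_ge0 Y).
  have /cvg_ex[/= l hl] : cvgn (series (a Y)).
    by apply: (geoC r0 r1) => s; apply: hM.
  by exists l.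
move=> Y; exists (F Y) => //.
have FE n : qfac Y q n * F Y = qfac (Y ^+ 2 * v) q (n + n) * F (Y * q ^+ n).
  elim: n => [|n IH]; first by rewrite !qfac0 expr0 mulr1.
  have R := arec _ _ _ (aF (Y * q ^+ n)) (aF (Y * q ^+ n * q)).
  rewrite qfacSr mulrAC IH -mulrA [F _ * _]mulrC R.
  rewrite (_ : Y * q ^+ n * q = Y * q ^+ n.+1); last by rewrite exprSr mulrA.
  by rewrite addSn addnS !qfacSr exprMn -exprM muln2 -addnn [q ^+ (n + n).+1]exprS; ring.
have w0 : Y * q ^+ n @[n --> \oo] --> 0.
  by rewrite -(mulr0 Y); exact: cvgMl_tmp (expr_cvg0 geoC q_lt1).
have F0 : F 0 = 1.
  apply: (cvgn_unique (aF 0)); apply: cvgn_shift.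
  apply: (@eq_cvgn _ _ (fun=> 1)); last exact: cvg_cst.
  by move=> n; rewrite /series /= big_nat_recl // a0 eqxx big1 ?addr0.
have [M hM] := aM `|Y| (normr_ge0 Y).
have FY : F (Y * q ^+ n) @[n --> \oo] --> (1 : C).
  rewrite -F0; apply: (cvg_dominated_series geoC r0 r1 (M := M)
    (a := fun n s => a (Y * q ^+ n) s)); last exact: aF.
  - move=> n s; apply: hM; rewrite normrM normrX ler_piMr //.
    by rewrite exprn_ile1 // ltW.
  - by move=> s; exact: acont.
  - by move=> n; exact: aF.
have c1 : qfac Y q n * F Y @[n --> \oo] --> qpoch_inf Y q * F Y.
  by apply: cvgMr_tmp; exact: cvg_qfac.
rewrite mulrC; apply: (cvgn_unique c1); apply: (eq_cvgn FE).
rewrite -[qpoch_inf (_ * v) q]mulr1; apply: cvgM FY.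
by apply: (cvgn_comp (g := fun n => (n + n)%N)); [move=> n; exact: leq_addl|exact: cvg_qfac].
Qed.

(** A functional equation follows from a closed form G for the difference of partial sums, once G
    tends to 0. The first sum runs one term further because the telescoping pairs term n + 1 of [u]
    with term n of [u']. *)
Lemma telescoped_recurrence (u u' G : nat -> C) (F F' c c' M t : C) :
  0 <= t -> t < 1 ->
  (forall n, c * series u n.+1 - c' * series u' n = G n) ->
  (forall n, `|G n| <= M * t ^+ n) ->
  series u @ \oo --> F -> series u' @ \oo --> F' -> c * F = c' * F'.
Proof.
move=> t0 t1 uG GM uF uF'.
have uF1 : series u n.+1 @[n --> \oo] --> F.
  by apply: (cvgn_comp (g := S)) uF => n; exact: leqnSn.
have G1 := dominated_cvg0 t0 t1 GM.
have G2 : G @ \oo --> c * F - c' * F'.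
  apply: (eq_cvgn (v := fun n => c * series u n.+1 - c' * series u' n)) => //.
  by apply: cvgB; exact: cvgMl_tmp.
by apply/eqP; rewrite -subr_eq0; apply/eqP; exact: cvgn_unique G2 G1.
Qed.

(** The case d = 0, multiplied by (Y^2)_oo = (Y^2)_s (Y^2 q^s)_oo, which turns the infinite products
    in the denominators into the numerators (Y^2)_s and avoids dividing by a product that may
    vanish. *)
Lemma sum_well_poised0 (Y : C) : exists2 l : C,
  series (fun s => (1 + Y * q ^+ s) * qfac (Y ^+ 2) q s / qfac q q s
                   * (Y ^+ s * q ^+ (s * s))) @ \oo --> l &
  l * qpoch_inf Y q = qpoch_inf (Y ^+ 2) q.
Proof.
have [Ki Ki0 hKi] := qfac_inv_bounded geoC q_lt1.
have ss s : ('C(s, 2) <= s * s)%N by rewrite bin2 leq_half_double; nia.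
have [||||l hl e] := geometric_iteration (a := fun Y s => (1 + Y * q ^+ s) *
  qfac (Y ^+ 2) q s / qfac q q s * (Y ^+ s * q ^+ (s * s))) (v := 1) _ _ _ _ Y;
  last (by exists l => //; rewrite e mulr1); clear Y.
- move=> X X0; have [M M0 hM] := gaussian_dominated X0.
  have [K K0 hK] := qfac_bounded geoC q_lt1 (exprn_ge0 2 X0).
  exists ((1 + X) * K * Ki * M) => Y s YX; apply: (hM Y _ _ s) => //.
  rewrite !normrM; apply: ler_pM; rewrite ?mulr_ge0 //.
  apply: ler_pM => //.
    apply: le_trans (ler_normD _ _) _; rewrite normr1 lerD2l normrM normrX.
    by rewrite -[leRHS]mulr1; apply: ler_pM; rewrite ?exprn_ge0 // exprn_ile1 // ltW.
  by apply: hK; rewrite normrX; apply: lerXn2r; rewrite ?nnegrE.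
- move=> w s w0; apply: cvgM; last by apply: cvgMr_tmp; exact: cvgn_exp.
  apply: cvgMr_tmp; apply: cvgM; last by apply: cvgn_qfac; exact: cvgn_exp.
  by apply: cvgD; [exact: cvg_cst | exact: cvgMr_tmp].
- case=> [|s]; last by rewrite [0 ^+ s.+1]expr0n !(mul0r, mulr0).
  by rewrite !qfac0 !expr0 mul0r addr0 !mulr1 divr1.
move=> Y F F'; have [M M0 hM] := gaussian_dominated (normr_ge0 Y).
have [K K0 hK] := qfac_bounded geoC q_lt1 (exprn_ge0 2 (normr_ge0 Y)).
(* [G] is the telescoping certificate, verified by induction on n after its bound has been
   proved. *)
apply: (telescoped_recurrence r0 r1 (M := K * Ki * M)
  (G := fun n => qfac (Y ^+ 2) q n.+1 / qfac q q n * (Y ^+ n * q ^+ (n * n + n)))); last first.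
  move=> n; apply: hM => //; first by apply: leq_trans (ss n) _; exact: leq_addr.
  by rewrite normrM; apply: ler_pM => //; apply: hK; rewrite normrX.
elim=> [|n IH].
  by rewrite /series /= big_nat1 big_nil !qfacSr !qfac0 !expr0 !mulr1 !divr1; ring.
rewrite /series /= in IH *; rewrite big_nat_recr //= mulrDr [in X in _ - X]big_nat_recr //= mulrDr.
rewrite opprD addrACA IH.
(* The prefactor completes (Y^2 q^2)_n to (Y^2)_(n+2). Everything is then a multiple of (Y^2)_(n+1),
   and the induction step becomes a rational identity. *)
have e : (1 - Y ^+ 2) * (1 - Y ^+ 2 * q) * qfac ((Y * q) ^+ 2) q n =
    qfac (Y ^+ 2) q n.+1 * (1 - Y ^+ 2 * q ^+ n.+1).
  rewrite -qfacSr qfacSl qfacSl -mulrA; congr (_ * (_ * qfac _ _ _)); ring.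
rewrite !mulr1.
have -> x y z : (1 - Y ^+ 2) * (1 - Y ^+ 2 * q) * (x * qfac ((Y * q) ^+ 2) q n / y * z) =
   (qfac (Y ^+ 2) q n.+1 * (1 - Y ^+ 2 * q ^+ n.+1)) * x / y * z.
  by rewrite -e; ring.
have d1 := qfac_qq_neq0 q_lt1 n; have := qfac_qq_neq0 q_lt1 n.+1.
rewrite (qfacSr q q n) mulf_eq0 negb_or => /andP[_ d2].
rewrite (qfacSr (Y ^+ 2) q n.+1).
have -> : (n.+1 * n.+1 = n * n + n + n + 1)%N by lia.
have -> : (n * n + n + n + 1 + n.+1 = n * n + n + n + n + 2)%N by lia.
rewrite !exprD !exprMn !exprS !expr0 in d2 *.
by field; rewrite d1 d2.
Qed.

(** The case d = 1, with v = 1/q. The argument is that of [sum_well_poised0] with another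
    certificate; here h(Y q^s) = 1 - Y^2 q^(2 s - 1). *)
Lemma sum_well_poised1 (Y : C) : q != 0 -> exists2 l : C,
  series (fun s => (1 - Y ^+ 2 / q * q ^+ (s + s)) * qfac (Y ^+ 2 / q) q s / qfac q q s
                   * (Y ^+ s * q ^+ (s * s.-1))) @ \oo --> l &
  l * qpoch_inf Y q = qpoch_inf (Y ^+ 2 / q) q.
Proof.
move=> qn0.
have [Ki Ki0 hKi] := qfac_inv_bounded geoC q_lt1.
have ss s : ('C(s, 2) <= s * s.-1)%N by rewrite bin2 leq_half_double; nia.
pose W X : C := X ^+ 2 / `|q|.
have W0 X : 0 <= X -> 0 <= W X by move=> X0; rewrite divr_ge0 ?exprn_ge0.
have WY Y' X : `|Y'| <= X -> `|Y' ^+ 2 / q| <= W X.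
  move=> YX; rewrite normrM normfV normrX ler_wpM2r ?invr_ge0 //.
  by apply: lerXn2r; rewrite ?nnegrE // (le_trans _ YX).
apply: (geometric_iteration (a := fun Y s => (1 - Y ^+ 2 / q * q ^+ (s + s)) *
  qfac (Y ^+ 2 / q) q s / qfac q q s * (Y ^+ s * q ^+ (s * s.-1)))) => {Y}.
- move=> X X0; have [M M0 hM] := gaussian_dominated X0.
  have [K K0 hK] := qfac_bounded geoC q_lt1 (W0 X X0).
  exists ((1 + W X) * K * Ki * M) => Y s YX; apply: (hM Y _ _ s) => //.
  rewrite !normrM; apply: ler_pM; rewrite ?mulr_ge0 //.
  apply: ler_pM => //; last by apply: hK; exact: WY.
  apply: le_trans (ler_normB _ _) _; rewrite normr1 lerD2l normrM [`|q ^+ _|]normrX.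
  rewrite -[leRHS]mulr1; apply: ler_pM; rewrite ?exprn_ge0 ?exprn_ile1 //.
    exact: WY.
  exact: ltW.
- move=> w s w0; apply: cvgM; last by apply: cvgMr_tmp; exact: cvgn_exp.
  have w2 : w n ^+ 2 / q @[n --> \oo] --> 0 ^+ 2 / q.
    by apply: cvgMr_tmp; exact: cvgn_exp.
  apply: cvgMr_tmp; apply: cvgM; last exact: cvgn_qfac.
  by apply: cvgB; [exact: cvg_cst | exact: cvgMr_tmp].
- case=> [|s]; last by rewrite [0 ^+ s.+1]expr0n !(mul0r, mulr0).
  by rewrite !qfac0 !expr0 expr0n !mul0r subr0 !mulr1 divr1.
move=> Y F F'; have [M M0 hM] := gaussian_dominated (normr_ge0 Y).
have [K K0 hK] := qfac_bounded geoC q_lt1 (W0 _ (normr_ge0 Y)).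
apply: (telescoped_recurrence r0 r1 (M := (1 + `|Y|) * K * Ki * M)
  (G := fun n => (1 - Y * q ^+ n) * qfac (Y ^+ 2 / q) q n.+1 / qfac q q n
     * (Y ^+ n * q ^+ (n * n)))); last first.
  move=> n; apply: hM => //; first by apply: leq_trans (ss n) _; rewrite leq_mul // leq_pred.
  rewrite !normrM; apply: ler_pM; rewrite ?mulr_ge0 //.
  apply: ler_pM => //; last by apply: hK; exact: WY.
  apply: le_trans (ler_normB _ _) _; rewrite normr1 lerD2l normrM normrX.
  by rewrite ler_piMr // exprn_ile1 // ltW.
elim=> [|n IH].
  by rewrite /series /= big_nat1 big_nil !qfacSr !qfac0 !expr0 !mulr1 !divr1; ring.
rewrite /series /= in IH *; rewrite big_nat_recr //= mulrDr [in X in _ - X]big_nat_recr //= mulrDr.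
rewrite opprD addrACA IH.
have e : (1 - Y ^+ 2 / q) * (1 - Y ^+ 2 / q * q) * qfac ((Y * q) ^+ 2 / q) q n =
    qfac (Y ^+ 2 / q) q n.+1 * (1 - Y ^+ 2 / q * q ^+ n.+1).
  by rewrite -qfacSr qfacSl qfacSl -mulrA; congr (_ * (_ * qfac _ _ _)); ring.
have -> x y z : (1 - Y ^+ 2 / q) * (1 - Y ^+ 2 / q * q) *
    (x * qfac ((Y * q) ^+ 2 / q) q n / y * z) =
   (qfac (Y ^+ 2 / q) q n.+1 * (1 - Y ^+ 2 / q * q ^+ n.+1)) * x / y * z.
  by rewrite -e; ring.
have d1 := qfac_qq_neq0 q_lt1 n; have := qfac_qq_neq0 q_lt1 n.+1.
rewrite (qfacSr q q n) mulf_eq0 negb_or => /andP[_ d2].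
rewrite (qfacSr (Y ^+ 2 / q) q n.+1).
(* Also true at n = 0, where the predecessor is truncated. All exponents are reduced to n and n (n -
   1) before [field]. *)
have E3 : (n * n = n * n.-1 + n)%N by case: (n) => //= k; lia.
have -> : (n.+1 * n = n * n.-1 + n + n)%N by rewrite mulSn E3 addnC.
have -> : (n.+1 * n.+1 = n * n.-1 + n + n + n + 1)%N.
  by rewrite mulSn mulnS E3; lia.
rewrite E3; set m := (n * n.-1)%N.
rewrite !exprD !exprMn !exprS !expr0 in d2 *.
by field; rewrite d1 d2 qn0.
Qed.

End WellPoised.

(** * Triangular exponents *)

Lemma bin2_mul2 n : ('C(n, 2) * 2 = n * n.-1)%N.
Proof. by elim: n => [|[|n] IH] //; rewrite binS bin1 mulnDl IH /=; lia. Qed.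

(* k (k - 1) / 2 *)
Definition tri (k : int) : nat :=
  match k with Posz n => 'C(n, 2) | Negz n => 'C(n.+2, 2) end.

Lemma tri_mul2 (k : int) : (tri k)%:Z * 2 = k * (k - 1).
Proof.
case: k => n; rewrite /tri; first by have := bin2_mul2 n; case: n => [|n] /=; nia.
by have := bin2_mul2 n.+2; rewrite NegzE /=; nia.
Qed.

Lemma tri_oppn (n : nat) : tri (- n%:Z) = 'C(n.+1, 2).
Proof. by case: n. Qed.

Lemma bin2_le_tri (k : int) : ('C(`|k|%N, 2) <= tri k)%N.
Proof. by case: k => n //=; rewrite [in leqRHS]binS leq_addr. Qed.

(** * Gaussian binomial coefficients and Cauchy's sum *)

Section QBinomial.
Variable C : numFieldType.
Hypothesis geoC : geometrically_complete C.
Variable q : C.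
Hypothesis q_lt1 : `|q| < 1.
Let r : C := 2^-1 ^+ 2.
Let r0 : 0 <= r. Proof. by rewrite exprn_ge0 // invr_ge0. Qed.
Let r1 : r < 1.
Proof. by rewrite exprn_ilt1 ?invr_ge0 ?invf_lt1 ?ltr1n. Qed.

(** The Gaussian binomial coefficient, defined by its Pascal rule: no division occurs and it
    vanishes for k > n, so the truncated n' - k' only matters when k' <= n'. *)
Fixpoint qbin (n k : nat) : C :=
  match n, k with
  | _, 0 => 1
  | 0, _.+1 => 0
  | n'.+1, k'.+1 => qbin n' k + q ^+ (n' - k') * qbin n' k'
  end.

Lemma qbin0 n : qbin n 0 = 1. Proof. by case: n. Qed.

Lemma qbinS n k : qbin n.+1 k.+1 = qbin n k.+1 + q ^+ (n - k) * qbin n k.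
Proof. by []. Qed.

Lemma qbin_small n k : (n < k)%N -> qbin n k = 0.
Proof.
elim: n k => [|n IH] [|k] //; rewrite ltnS => nk.
by rewrite qbinS !IH ?mulr0 ?addr0 // ltnW.
Qed.

Lemma qbin_fact m k : qbin (k + m) k * (qfac q q k * qfac q q m) = qfac q q (k + m).
Proof.
move: {2}(k + m)%N (erefl (k + m)%N) => n e.
elim: n k m e => [|n IH] [|k] m e //; try by rewrite add0n qbin0 qfac0 !mul1r.
case: m e => [|m] e.
  have := IH k 0%N; rewrite addn0 => IHk; rewrite addn0 in e.
  rewrite addn0 qbinS qbin_small // add0r subnn expr0 mul1r qfac0 mulr1 qfacSr.
  by rewrite qfac0 mulr1 in IHk; rewrite mulrA IHk //; lia.
rewrite addnS qbinS.
have IH1 := IH k.+1 m; have IH2 := IH k m.+1.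
rewrite addSn in IH1; rewrite addnS in IH2.
rewrite addSn (_ : (k + m).+1 - k = m.+1)%N; last by lia.
(* The inductive step rests on 1 - q^(k+m+2) = (1 - q^(m+1)) + q^(m+1) (1 - q^(k+1)), one summand
   for each term of the Pascal rule. *)
rewrite (qfacSr q q (k + m).+1) [LHS](_ : _ =
  qbin (k + m).+1 k.+1 * (qfac q q k.+1 * qfac q q m) * (1 - q ^+ m.+1)
  + q ^+ m.+1 * (1 - q ^+ k.+1) * (qbin (k + m).+1 k * (qfac q q k * qfac q q m.+1))).
  rewrite IH1; last by lia.
  rewrite IH2; last by lia.
  rewrite !exprS exprD; ring.
rewrite (qfacSr q q k) (qfacSr q q m) !exprS; ring.
Qed.

Lemma qbinE n k : (k <= n)%N -> qbin n k = qfac q q n / (qfac q q k * qfac q q (n - k)).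
Proof.
move=> kn; have := qbin_fact (n - k) k; rewrite subnKC // => <-.
by rewrite mulfK // mulf_neq0 // qfac_qq_neq0.
Qed.

Lemma qbin_bounded : exists2 K : C, 0 <= K & forall n k, `|qbin n k| <= K.
Proof.
have [Ki Ki0 hKi] := qfac_inv_bounded geoC q_lt1.
have [K K0 hK] := qfac_bounded geoC q_lt1 (ler01 : 0 <= 1 :> C).
exists (K * (Ki * Ki)); first by rewrite !mulr_ge0.
move=> n k; have [nk|kn] := ltnP n k.
  by rewrite qbin_small // normr0 !mulr_ge0.
rewrite qbinE // invfM !normrM.
by do 2?[apply: ler_pM; rewrite ?mulr_ge0 //]; apply: hK; exact: ltW.
Qed.

(** In the Pascal rule the first term reproduces the sum of order n and the second gives -x q^n
    times it; together they make the new factor 1 - x q^n. *)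
Lemma qbinomial_theorem x n :
  \sum_(0 <= j < n.+1) qbin n j * ((- x) ^+ j * q ^+ 'C(j, 2)) = qfac x q n.
Proof.
elim: n => [|n IH]; first by rewrite big_nat1 qfac0 !expr0 !mulr1.
rewrite qfacSr -IH big_nat_recl // qbin0 mul1r.
under eq_bigr do rewrite qbinS mulrDl.
rewrite big_split /= addrA.
have -> : (- x) ^+ 0 * q ^+ 'C(0, 2) +
    \sum_(0 <= i < n.+1) qbin n i.+1 * ((- x) ^+ i.+1 * q ^+ 'C(i.+1, 2)) =
    \sum_(0 <= j < n.+1) qbin n j * ((- x) ^+ j * q ^+ 'C(j, 2)).
  transitivity (\sum_(0 <= j < n.+2) qbin n j * ((- x) ^+ j * q ^+ 'C(j, 2))).
    by rewrite [RHS]big_nat_recl // qbin0 mul1r.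
  by rewrite big_nat_recr //= qbin_small // mul0r addr0.
rewrite mulrBr mulr1; congr (_ + _); rewrite mulr_suml -sumrN.
rewrite big_nat [RHS]big_nat; apply: eq_bigr => j /andP[_ jn].
rewrite binS bin1 exprD exprS -[in q ^+ n](subnK (_ : j <= n)%N) // exprD; ring.
Qed.

(** A finite form of Cauchy's sum. The Pascal rule splits order n + 1 into (1 - A q^(n+1)) times the
    sum at A plus A q^(n+1) times the sum at A q, both of order n; hence the induction for all A at
    once. *)
Lemma cauchy_finite (A : C) n :
  \sum_(0 <= s < n.+1) qbin n s * qfac (A * q ^+ s.+1) q (n - s)
     * (A ^+ s * q ^+ (s * s)) = 1.
Proof.
elim: n A => [|n IH] A; first by rewrite big_nat1 qfac0 !expr0 !mulr1.
rewrite big_nat_recl // qbin0 mul1r subn0.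
under eq_bigr do rewrite qbinS !mulrDl.
rewrite big_split /= addrA.
rewrite [X in X + _](_ : _ = 1 - A * q ^+ n.+1); last first.
  rewrite -[RHS]mul1r -[X in _ = X * _](IH A) mulr_suml [RHS]big_nat_recl //.
  have qM m m' : A * q ^+ m * q ^+ m' = A * q ^+ (m + m') by rewrite -mulrA -exprD.
  rewrite qbin0 mul1r subn0 qfacSr qM add1n [qfac _ q n * _ * _]mulrAC; congr (_ + _).
  rewrite big_nat_recr //= [qbin n n.+1]qbin_small // !mul0r addr0.
  rewrite big_nat [RHS]big_nat; apply: eq_bigr => s /andP[_ sn].
  rewrite subSS -(subnSK sn) qfacSr qM.
  rewrite (_ : s.+2 + (n - s.+1) = n.+1)%N; [ring | lia].
rewrite [X in _ + X](_ : _ = A * q ^+ n.+1); first by rewrite subrK.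
rewrite -[RHS]mulr1 -[X in _ = _ * X](IH (A * q)) mulr_sumr big_nat [RHS]big_nat.
apply: eq_bigr => s /andP[_ sn]; rewrite subSS exprMn.
rewrite -[A * q * q ^+ _]mulrA -exprS.
have -> : (s.+1 * s.+1 = s * s + s + s + 1)%N by lia.
rewrite -[in q ^+ n.+1](subnK (_ : s <= n)%N) // -addnS !exprD !exprS expr0; ring.
Qed.

Lemma qbin_cvg s : qbin n s @[n --> \oo] --> (qfac q q s)^-1.
Proof.
rewrite -(cvg_shiftn s).
have e n : qbin (n + s) s = qfac q q (n + s) * ((qfac q q n)^-1 * (qfac q q s)^-1).
  by rewrite qbinE ?leq_addl // addnK invfM [X in _ * X]mulrC.
apply: (eq_cvgn e).
have c1 : qfac q q (n + s)%N @[n --> \oo] --> qpoch_inf q q.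
  apply: (cvgn_comp (g := addn^~ s)); first by move=> n; exact: leq_addr.
  exact: cvg_qfac.
have c2 : (qfac q q n)^-1 @[n --> \oo] --> (qpoch_inf q q)^-1.
  exact: (cvgV (qpoch_inf_qq_neq0 geoC q_lt1) (cvg_qfac geoC q_lt1 (x := q))).
rewrite -[X in _ @ _ --> X](mulVKf (qpoch_inf_qq_neq0 geoC q_lt1)).
exact: (cvgM c1 (cvgMr_tmp (b := (qfac q q s)^-1) c2)).
Qed.

(** The limit of [cauchy_finite] as n tends to infinity, by Tannery's theorem: [qbin n s] tends to
    1/(q)_s and the finite factorial to the infinite one. *)
Lemma cauchy_sum (A : C) :
  series (fun s => qpoch_inf (A * q ^+ s.+1) q / qfac q q s * (A ^+ s * q ^+ (s * s)))
    @ \oo --> (1 : C).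
Proof.
have [M M0 hM] := gaussian_dominated geoC q_lt1 (normr_ge0 A).
have [Kb Kb0 hKb] := qbin_bounded.
have [Ki Ki0 hKi] := qfac_inv_bounded geoC q_lt1.
have [K K0 hK] := qfac_bounded geoC q_lt1 (normr_ge0 A).
have [K' K'0 hK'] := qpoch_inf_bounded geoC q_lt1 (normr_ge0 A).
have ss s : ('C(s, 2) <= s * s)%N by rewrite bin2 leq_half_double; nia.
have As s : `|A * q ^+ s| <= `|A|.
  by rewrite normrM normrX ler_piMr // exprn_ile1 // ltW.
set b := fun s => _.
have /cvg_ex[/= B hB] : cvgn (series b).
  apply: (geoC (M := K' * Ki * M) r0 r1) => s; apply: (hM A _ _ s) => //.
  by rewrite normrM; apply: ler_pM => //; apply: hK'.
pose a n s : C := qbin n s * qfac (A * q ^+ s.+1) q (n - s) * (A ^+ s * q ^+ (s * s)).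
suff -> : 1 = B by [].
apply: (@cvgn_unique _ (fun=> 1)); first exact: cvg_cst.
apply: (cvg_dominated_series geoC r0 r1 (M := Kb * K * M) (a := a) _ _ _ hB).
- move=> n s; apply: (hM A _ _ s) => //.
  by rewrite normrM; apply: ler_pM => //; apply: hK.
- move=> s; rewrite /b [qpoch_inf _ q / _]mulrC.
  have h : qfac (A * q ^+ s.+1) q (n - s) @[n --> \oo] --> qpoch_inf (A * q ^+ s.+1) q.
    rewrite -(cvg_shiftn s).
    apply: (eq_cvgn (v := qfac (A * q ^+ s.+1) q)); last exact: cvg_qfac.
    by move=> n; rewrite /= addnK.
  exact: (cvgMr_tmp (cvgM (qbin_cvg (s := s)) h)).
- move=> n; rewrite -(cvg_shiftn n.+1).
  apply: (@eq_cvgn _ _ (fun=> 1)); last exact: cvg_cst.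
  move=> k; rewrite /series /= (big_cat_nat _ (n := n.+1)) ?leq_addl //=.
  rewrite cauchy_finite big_nat big1 ?addr0 // => i /andP[ni _].
  by rewrite /a qbin_small // !mul0r.
Qed.

End QBinomial.

(** * Jacobi's triple product and theta functions *)

Section Theta.
Variable C : numFieldType.
Hypothesis geoC : geometrically_complete C.
Variable q : C.
Hypothesis q_lt1 : `|q| < 1.
Hypothesis q_neq0 : q != 0.
Let r : C := 2^-1 ^+ 2.
Let r0 : 0 <= r. Proof. by rewrite exprn_ge0 // invr_ge0. Qed.
Let r1 : r < 1.
Proof. by rewrite exprn_ilt1 ?invr_ge0 ?invf_lt1 ?ltr1n. Qed.

(** Factor by factor, (1 - x/q^j) q^j = -x (1 - q^j/x) for 1 <= j <= n. *)
Lemma qfac_reverse x n : x != 0 ->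
  qfac (x / q ^+ n) q n * q ^+ 'C(n.+1, 2) = (- x) ^+ n * qfac (q / x) q n.
Proof.
move=> x0; elim: n => [|n IH]; first by rewrite !qfac0 !expr0.
have -> : qfac (x / q ^+ n.+1) q n.+1 = (1 - x / q ^+ n.+1) * qfac (x / q ^+ n) q n.
  rewrite qfacSl; congr (_ * qfac _ _ _).
  by rewrite exprS; field; rewrite q_neq0 expf_neq0.
rewrite binS bin1 exprD [q ^+ 'C(_, _) * _]mulrC mulrACA IH qfacSr !exprS.
by field; rewrite x0 q_neq0 expf_neq0.
Qed.

Lemma qbin_sym n k : (k <= n)%N -> qbin q n (n - k) = qbin q n k.
Proof.
by move=> kn; rewrite !qbinE ?leq_subr // subKn // [X in _ / X]mulrC.
Qed.

Lemma qbin_mid_cvg j : qbin q (n + n) (n + j) @[n --> \oo] --> (qpoch_inf q q)^-1.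
Proof.
have P0 := qpoch_inf_qq_neq0 geoC q_lt1.
rewrite -(cvg_shiftn j).
have e n : qbin q (n + j + (n + j)) (n + j + j) = qfac q q (n + j + (n + j)) *
    ((qfac q q (n + j + j))^-1 * (qfac q q n)^-1).
  by rewrite qbinE ?leq_add2r ?leq_add2l ?leq_addl // invfM; congr (_ * (_ * (qfac _ _ _)^-1)); lia.
apply: (eq_cvgn e).
have c g : (forall n, (n <= g n)%N) -> qfac q q (g n) @[n --> \oo] --> qpoch_inf q q.
  by move=> gn; apply: (cvgn_comp gn); exact: cvg_qfac.
have cV g : (forall n, (n <= g n)%N) ->
    (qfac q q (g n))^-1 @[n --> \oo] --> (qpoch_inf q q)^-1.
  by move=> gn; exact: (cvgV P0 (c g gn)).
rewrite -[X in _ @ _ --> X](mulVKf P0).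
have h1 := c (fun n => n + j + (n + j))%N (fun n => leq_trans (leq_addr j n) (leq_addr _ _)).
have h2 := cV (fun n => n + j + j)%N (fun n => leq_trans (leq_addr j n) (leq_addr _ _)).
exact: (cvgM h1 (cvgM h2 (cV id (@leqnn)))).
Qed.

(** This is the q-binomial theorem of order 2n at x/q^n, cut at index n. By [qfac_reverse] the first
    n factors of (x/q^n)_(2n) yield (q/x)_n, and the last n are (x)_n. *)
Lemma finite_triple_product (x : C) n : x != 0 ->
  \sum_(0 <= j < n.+1) qbin q (n + n) (n + j) * ((- x) ^+ j * q ^+ 'C(j, 2)) +
  \sum_(0 <= i < n) qbin q (n + n) (n + i.+1) * ((- x) ^- i.+1 * q ^+ 'C(i.+2, 2)) =
  qfac x q n * qfac (q / x) q n.
Proof.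
move=> x0; have mx0 : - x != 0 by rewrite oppr_eq0.
have qn0 m : q ^+ m != 0 by rewrite expf_neq0.
have xn0 m : (- x) ^+ m != 0 by rewrite expf_neq0.
(* Here m + i.+1 plays the role of n: the binomial term of index m < n becomes the bilateral term of
   index -(i + 1). *)
have left_term m i : (- (x / q ^+ (m + i.+1))) ^+ m * q ^+ 'C(m, 2)
      * q ^+ 'C((m + i.+1).+1, 2) =
    (- x) ^+ (m + i.+1) * ((- x) ^- i.+1 * q ^+ 'C(i.+2, 2)).
  have e : ('C(m, 2) + 'C((m + i.+1).+1, 2) = (m + i.+1) * m + 'C(i.+2, 2))%N.
    have := bin2_mul2 m; have := bin2_mul2 (m + i.+1).+1; have := bin2_mul2 i.+2.
    by move=> /=; case: (m) => [|m'] /=; nia.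
  rewrite -mulrA -exprD e [q ^+ (_ * _ + _)]exprD [q ^+ (_ * _)]exprM -mulNr exprMn exprVn (exprD (- x)).
  by field; rewrite -exprM xn0 qn0.
have right_term k : (- (x / q ^+ n)) ^+ (n + k) * q ^+ 'C(n + k, 2) * q ^+ 'C(n.+1, 2) =
    (- x) ^+ n * ((- x) ^+ k * q ^+ 'C(k, 2)).
  have e : ('C(n + k, 2) + 'C(n.+1, 2) = n * (n + k) + 'C(k, 2))%N.
    have := bin2_mul2 (n + k); have := bin2_mul2 n.+1; have := bin2_mul2 k.
    by move=> /=; case: (n) => [|n'] /=; case: (k) => [|k'] /=; nia.
  rewrite -mulrA -exprD e [q ^+ (_ * _ + _)]exprD [q ^+ (_ * _)]exprM -mulNr exprMn exprVn (exprD (- x)).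
  by field; rewrite -exprM qn0.
apply: (mulfI (xn0 n)).
have -> : (- x) ^+ n * (qfac x q n * qfac (q / x) q n) =
    qfac (x / q ^+ n) q (n + n) * q ^+ 'C(n.+1, 2).
  by rewrite qfacD divfK // mulrAC qfac_reverse //; ring.
rewrite -qbinomial_theorem mulr_suml.
rewrite (big_cat_nat _ (n := n) (p := (n + n).+1)) //=; last by lia.
rewrite [RHS]addrC mulrDr; congr (_ + _); last first.
  rewrite mulr_sumr [RHS]big_nat_rev [LHS]big_nat [RHS]big_nat; apply: eq_bigr => i /andP[_ ni].
  rewrite -[qbin q (n + n) (n + i.+1)]qbin_sym; last by lia.
  rewrite add0n (_ : n + n - (n + i.+1) = n - i.+1)%N; last by lia.
  have := left_term (n - i.+1)%N i; rewrite subnK // => h.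
  by rewrite -mulrA h; ring.
rewrite mulr_sumr -[X in _ = \sum_(X <= _ < _) _]add0n big_addn subSn ?leq_addl // addnK.
apply: eq_bigr => k _; rewrite [(k + n)%N]addnC -mulrA right_term; ring.
Qed.

Lemma cvg_series_finite (u : nat -> C) n : (forall k, (n <= k)%N -> u k = 0) ->
  series u @ \oo --> \sum_(0 <= i < n) u i.
Proof.
move=> u0; rewrite -(cvg_shiftn n).
apply: (@eq_cvgn _ _ (fun=> \sum_(0 <= i < n) u i)); last exact: cvg_cst.
move=> k; rewrite /series /= (big_cat_nat _ (n := n) (p := (k + n)%N)) ?leq_addl //=.
by rewrite [X in _ + X]big_nat [X in _ + X]big1 ?addr0 // => i /andP[ni _]; exact: u0.
Qed.

(** Each half of [finite_triple_product] passes to the limit by Tannery's theorem, the central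
    coefficients tending to 1/(q)_oo. *)
Theorem jacobi_triple_product (x : C) : x != 0 ->
  bilateral_sum_to (fun k => (- x) ^ k * q ^+ tri k)
    (qpoch_inf q q * (qpoch_inf x q * qpoch_inf (q / x) q)).
Proof.
move=> x0; have P0 := qpoch_inf_qq_neq0 geoC q_lt1.
have [Kb Kb0 hKb] := qbin_bounded geoC q_lt1.
pose u j := (- x) ^+ j * q ^+ 'C(j, 2).
pose v i := (- x) ^- i.+1 * q ^+ 'C(i.+2, 2).
have [Mu Mu0 hu] : exists2 M : C, 0 <= M & forall c K s, `|c| <= K ->
    `|c * u s| <= K * M * r ^+ s.
  have [M M0 hM] := gaussian_dominated geoC q_lt1 (normr_ge0 (- x)).
  by exists M => // c K s cK; apply: hM.
have [Mv Mv0 hv] : exists2 M : C, 0 <= M & forall c K s, `|c| <= K ->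
    `|c * v s| <= K * M * r ^+ s.
  have [M M0 hM] := gaussian_dominated geoC q_lt1 (normr_ge0 (- x)^-1).
  exists (`|(- x)^-1| * M); first by rewrite mulr_ge0.
  move=> c K s cK; rewrite [K * _]mulrA.
  have -> : c * v s = c * (- x)^-1 * ((- x)^-1 ^+ s * q ^+ 'C(s.+2, 2)).
    by rewrite /v exprVn exprS invfM !mulrA.
  apply: hM => //; first by rewrite leq_bin2l //; lia.
  by rewrite normrM ler_wpM2r.
(* One argument for both halves: [sh] is 0 for k >= 0 and 1 for k < 0. In the second case the extra
   term j = n has coefficient 0. *)
have half (w : nat -> C) (M : C) (sh : nat) : (forall c K s, `|c| <= K ->
    `|c * w s| <= K * M * r ^+ s) ->
    exists2 l : C, series w @ \oo --> l &
      \sum_(0 <= j < n.+1) qbin q (n + n) (n + (j + sh)) * w j @[n --> \oo]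
        --> (qpoch_inf q q)^-1 * l.
  move=> wM.
  have /cvg_ex[/= l hl] : cvgn (series w).
    by apply: (geoC r0 r1 (M := 1 * M)) => s; rewrite -[w s]mul1r wM ?normr1.
  exists l => //.
  apply: (cvg_dominated_series geoC r0 r1 (M := Kb * M)
    (a := fun n j => qbin q (n + n) (n + (j + sh)) * w j) _ _ _
    (cvg_seriesZ (c := (qpoch_inf q q)^-1) hl)).
  - by move=> n s; apply: wM.
  - by move=> s; apply: cvgMr_tmp; exact: qbin_mid_cvg.
  - move=> n; apply: cvg_series_finite => k nk; rewrite qbin_small ?mul0r //; lia.
have [l1 ul1 A1] := half u Mu 0%N hu.
have [l2 vl2 B2] := half v Mv 1%N hv.
have e n : qfac x q n * qfac (q / x) q n =
    \sum_(0 <= j < n.+1) qbin q (n + n) (n + (j + 0)) * u j +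
    \sum_(0 <= j < n.+1) qbin q (n + n) (n + (j + 1)) * v j.
  rewrite -finite_triple_product //; congr (_ + _).
    by apply: eq_bigr => j _; rewrite addn0.
  rewrite [RHS]big_nat_recr //= addn1 qbin_small ?mul0r ?addr0; last by lia.
  by apply: eq_bigr => j _; rewrite addn1.
have h : qpoch_inf x q * qpoch_inf (q / x) q =
    (qpoch_inf q q)^-1 * l1 + (qpoch_inf q q)^-1 * l2.
  apply: (cvgn_unique (u := fun n => qfac x q n * qfac (q / x) q n)).
    by apply: cvgM; exact: cvg_qfac.
  exact: (eq_cvgn e (cvgD A1 B2)).
by exists l1, l2; split; [exact: ul1 | exact: vl2 | rewrite h -mulrDr mulVKf].
Qed.

Definition theta (x : C) : C := qpoch_inf x q * qpoch_inf (q / x) q.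

Lemma thetaS x : x != 0 -> theta x = - x * theta (x * q).
Proof.
move=> x0; rewrite /theta (qpoch_infS geoC q_lt1 x).
have -> : q / (x * q) = x^-1 by field; rewrite x0 q_neq0.
by rewrite (qpoch_infS geoC q_lt1 x^-1) [x^-1 * q]mulrC; field.
Qed.

(** Iteration of [thetaS] for k >= 0; a negative shift is the positive one started at x q^k. *)
Lemma theta_shift x (k : int) : x != 0 ->
  theta x = (- x) ^ k * q ^+ tri k * theta (x * q ^ k).
Proof.
move=> x0.
have pos (n : nat) (y : C) : y != 0 ->
    theta y = (- y) ^+ n * q ^+ 'C(n, 2) * theta (y * q ^+ n).
  move=> y0; elim: n => [|n IH]; first by rewrite !expr0 !mul1r mulr1.
  rewrite IH thetaS ?mulf_neq0 ?expf_neq0 // -[y * q ^+ n * q]mulrA -exprSr.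
  by rewrite binS bin1 exprD [(- y) ^+ n.+1]exprSr; ring.
case: k => n; first exact: pos.
rewrite /tri NegzE -!exprnN (pos n.+1 (x / q ^+ n.+1)); last first.
  by rewrite mulf_neq0 // invr_eq0 expf_neq0.
have qn m : q ^+ m != 0 by rewrite expf_neq0.
have xn m : (- x) ^+ m != 0 by rewrite expf_neq0 // oppr_eq0.
rewrite divfK // -mulNr exprMn exprVn -exprM.
have e : ('C(n.+2, 2) + 'C(n.+1, 2) = n.+1 * n.+1)%N.
  by have := bin2_mul2 n.+2; have := bin2_mul2 n.+1 => /=; nia.
by rewrite -e exprD; field; rewrite xn !qn.
Qed.

(** For m = -n the factors (x/q^n)_n blow up like |q|^(-tri m). By [qfac_reverse] the weight
    |q|^(tri m) compensates this exactly and leaves |x|^n. *)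
Lemma qpoch_inf_shift_le (x : C) : x != 0 -> exists2 K : C, 0 <= K &
  forall m : int, `|qpoch_inf (x * q ^ m) q| * `|q| ^+ tri m <= K * (1 + `|x|) ^+ `|m|%N.
Proof.
move=> x0; have x1 : 1 <= 1 + `|x| by rewrite lerDl.
have [K1 K10 hK1] := qpoch_inf_bounded geoC q_lt1 (normr_ge0 x).
have [K2 K20 hK2] := qfac_bounded geoC q_lt1 (normr_ge0 (q / x)).
exists (K1 * (1 + K2)); first by rewrite mulr_ge0 ?addr_ge0.
case=> n.
  apply: (@le_trans _ _ K1).
    rewrite -[leRHS]mulr1; apply: ler_pM; rewrite ?exprn_ge0 //; last by rewrite exprn_ile1 // ltW.
    by apply: hK1; rewrite normrM normrX ler_piMr // exprn_ile1 // ltW.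
  rewrite -mulrA ler_peMr // mulr_ege1 ?exprn_ege1 //.
  by rewrite lerDl.
rewrite NegzE -exprnN abszN absz_nat /tri -normrX mulrC -normrM.
have qn m : q ^+ m != 0 by rewrite expf_neq0.
rewrite (qpoch_infD geoC q_lt1 _ n.+1) divfK // mulrA [q ^+ _ * _]mulrC qfac_reverse //.
rewrite [leLHS](_ : _ = `|qpoch_inf x q| * (`|qfac (q / x) q n.+1| * `|x| ^+ n.+1)).
  rewrite -mulrA; apply: ler_pM; rewrite ?mulr_ge0 ?exprn_ge0 ?hK1 //.
  apply: ler_pM; rewrite ?exprn_ge0 //.
    by apply: le_trans (hK2 _ _ (lexx _)) _; rewrite lerDr.
  by apply: lerXn2r; rewrite ?nnegrE ?addr_ge0 // lerDr.
by rewrite !normrM normrX normrN; ring.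
Qed.

End Theta.

(** * Removal of (zq)_k from the bilateral series *)

Section BilateralRogersRamanujan.
Variable C : numFieldType.
Hypothesis geoC : geometrically_complete C.
Variable q : C.
Hypothesis q_lt1 : `|q| < 1.
Hypothesis q_neq0 : q != 0.

Lemma qpoch_negE (x : C) n : qpoch x q (- n.+1%:Z) = (qfac (x / q ^+ n.+1) q n.+1)^-1.
Proof.
rewrite -NegzE /qpoch prodfV; congr (_^-1).
rewrite big_add1 /= /qfac [RHS]big_nat_rev [LHS]big_nat [RHS]big_nat add0n.
apply: eq_bigr => i /andP[_ ni]; congr (1 - _); rewrite -mulrA; congr (_ * _).
have {1}-> : n.+1 = (n.+1 - i.+1 + i.+1)%N by rewrite subnK.
by rewrite exprD; field; rewrite !expf_neq0.
Qed.

(** For k >= 0 the product (q^(-k)/z)_oo splits off (q^(-k)/z)_k, which reverses into (zq)_k. For k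
    < 0 it is (1/z)_oo that splits, and the nonvanishing hypothesis makes the inverse in [qpoch] a
    genuine one. *)
Lemma qpoch_inf_reflect (z : C) (k : int) : z != 0 -> qpoch (z * q) q k != 0 ->
  qpoch_inf (z^-1 * q ^ (- k)) q * (- z) ^ k * q ^+ tri (k + 1) =
  qpoch (z * q) q k * qpoch_inf z^-1 q.
Proof.
move=> z0; have qn m : q ^+ m != 0 by rewrite expf_neq0.
have zn m : (- z) ^+ m != 0 by rewrite expf_neq0 // oppr_eq0.
case: k => n.
  move=> _; rewrite qpoch_natE -exprnN (_ : tri (n%:Z + 1) = 'C(n.+1, 2)); last first.
    by rewrite -PoszD addn1.
  rewrite (qpoch_infD geoC q_lt1 _ n) divfK //.
  have := qfac_reverse q_neq0 n (invr_neq0 z0); rewrite invrK [q * z]mulrC => e.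
  rewrite -exprnP; set Q := qpoch_inf _ _; set w := (- z) ^+ n.
  rewrite [LHS](_ : _ = (qfac (z^-1 / q ^+ n) q n * q ^+ 'C(n.+1, 2)) * w * Q).
    by rewrite e -invrN exprVn -/w; field; exact: zn.
  by ring.
rewrite NegzE qpoch_negE opprK invr_eq0 => nz.
rewrite (qpoch_infD geoC q_lt1 z^-1 n.+1).
have -> : tri (- n.+1%:Z + 1) = 'C(n.+1, 2).
  by rewrite (_ : - n.+1%:Z + 1 = - n%:Z) ?tri_oppn //; lia.
have e := qfac_reverse q_neq0 n.+1 (mulf_neq0 z0 q_neq0).
have -> : qfac z^-1 q n.+1 = qfac (q / (z * q)) q n.+1.
  by congr qfac; field; rewrite z0 q_neq0.
rewrite -exprnN -exprnP; set Q := qpoch_inf _ _.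
set a := qfac (z * q / _) q _ in e nz *; set b := qfac (q / _) q _ in e *.
have -> : b = a * q ^+ 'C(n.+2, 2) / (- (z * q)) ^+ n.+1.
  by rewrite e mulrC mulKf // expf_neq0 // oppr_eq0 mulf_neq0.
rewrite ['C(n.+2, 2)]binS bin1 exprD -mulNr exprMn.
by field; rewrite nz zn qn.
Qed.

Lemma norm_exprz_le (w : C) (k : int) :
  `|w ^ k| <= (`|w| + `|w|^-1) ^+ `|k|%N.
Proof.
case: k => n.
  by rewrite -exprnP normrX lerXn2r ?nnegrE ?addr_ge0 ?invr_ge0 // lerDl invr_ge0.
rewrite NegzE -exprnN abszN absz_nat normfV normrX -exprVn.
by apply: lerXn2r; rewrite ?nnegrE ?addr_ge0 ?invr_ge0 // lerDr.
Qed.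

(** * The double series common to both identities *)

Section Core.
Variables (z : C) (d : nat) (h : C -> C).
Hypothesis z_neq0 : z != 0.
Hypothesis d_le1 : (d <= 1)%N.

(** With monomials in this form, identities between them reduce to integer arithmetic on the
    exponents. *)
Let mono (a b : int) : C := z ^ a * q ^ b.

Let monoM a b a' b' : mono a b * mono a' b' = mono (a + a') (b + b').
Proof. by rewrite /mono !expfzDr //; ring. Qed.

Let monoX a b (n : nat) : mono a b ^+ n = mono (a * n%:Z) (b * n%:Z).
Proof. by rewrite /mono exprMn -!exprz_exp. Qed.

Let mono_neq0 a b : mono a b != 0.
Proof. by rewrite mulf_neq0 // expfz_neq0. Qed.

Let monoq (n : nat) : q ^+ n = mono 0 n%:Z.
Proof. by rewrite /mono expr0z mul1r. Qed.

Let monoqz (b : int) : q ^ b = mono 0 b.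
Proof. by rewrite /mono expr0z mul1r. Qed.

Let monoZ a b (k : int) : mono a b ^ k = mono (a * k) (b * k).
Proof. by rewrite /mono expfzMl !exprz_exp. Qed.

Let monoV a b : (mono a b)^-1 = mono (- a) (- b).
Proof. by rewrite /mono invfM !invr_expz. Qed.

Hypothesis h_sum : forall Y : C, exists2 l : C,
  series (fun s => h (Y * q ^+ s) * qfac (Y ^+ 2 / q ^+ d) q s / qfac q q s
                   * (Y ^+ s * q ^+ (s * (s - d)))) @ \oo --> l &
  l * qpoch_inf Y q = qpoch_inf (Y ^+ 2 / q ^+ d) q.

(** As tri r = (r^2 - r)/2, the exponent of q is (5 r^2 + r)/2 + 3 d r. *)
Let alpha0 (r : int) : C :=
  (-1) ^ r * mono (5 * r) (2 * r * r + r + 3 * d%:Z * r + (tri r)%:Z).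

Let alpha (r : int) : C := alpha0 r * h (mono (-1) (- r)).

(** The double series after the substitution r = k - s: row r is [alpha r] times Cauchy's sum with A
    = z^2 q^(2 r + d). *)
Let T (r : int) (s : nat) : C :=
  alpha r * (qpoch_inf (mono 2 (2 * r + d%:Z) * q ^+ s.+1) q / qfac q q s
             * (mono 2 (2 * r + d%:Z) ^+ s * q ^+ (s * s))).

Let T_row r : series (T r) @ \oo --> alpha r.
Proof.
rewrite -[X in _ @ _ --> X]mulr1.
exact: (cvg_seriesZ (c := alpha r) (cauchy_sum geoC q_lt1 (mono 2 (2 * r + d%:Z)))).
Qed.

Let signB (k : int) (s : nat) : (-1) ^ (k - s%:Z) = (-1) ^ k * (-1) ^+ s :> C.
Proof.
rewrite expfzDr ?oppr_eq0 ?oner_eq0 // -exprnN; congr (_ * _).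
by rewrite -exprVn invrN invr1.
Qed.

(** Along r = k - s the term is the well-poised summand at Y = q^(-k)/z, up to a factor depending on
    k only. With x = z^2 q^(2 k + d + 1), the product (x/q^s)_oo splits off (x/q^s)_s, which
    reverses into (q/x)_s = (Y^2 q^(-d))_s. *)
Let T_diag (k : int) (s : nat) :
  T (k - s%:Z) s =
  alpha0 k * qpoch_inf (mono 2 (2 * k + d%:Z + 1)) q *
  (h (mono (-1) (- k) * q ^+ s) * qfac (mono (-1) (- k) ^+ 2 / q ^+ d) q s / qfac q q s
                   * (mono (-1) (- k) ^+ s * q ^+ (s * (s - d)))).
Proof.
rewrite /T /alpha.
have -> : mono (-1) (- (k - s%:Z)) = mono (-1) (- k) * q ^+ s.
  by rewrite monoq monoM; congr mono; lia.
have -> : mono (-1) (- k) ^+ 2 / q ^+ d = q / mono 2 (2 * k + d%:Z + 1).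
  by rewrite monoX -[q in RHS]expr1 !monoq !monoV !monoM; congr mono; lia.
set x := mono 2 (2 * k + d%:Z + 1).
have -> : mono 2 (2 * (k - s%:Z) + d%:Z) * q ^+ s.+1 = x / q ^+ s.
  by rewrite /x !monoq monoV !monoM; congr mono; lia.
have x0 : x != 0 by exact: mono_neq0.
have qn m : q ^+ m != 0 by rewrite expf_neq0.
rewrite (qpoch_infD geoC q_lt1 _ s) divfK //.
have -> : qfac (x / q ^+ s) q s = (- x) ^+ s / q ^+ 'C(s.+1, 2) * qfac (q / x) q s.
  by apply: (mulIf (qn 'C(s.+1, 2))); rewrite qfac_reverse // mulrAC divfK.
rewrite /alpha0 signB; set H := h _; set Q := qfac (q / x) q s; set P := qpoch_inf x q.
set D := (qfac q q s)^-1.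
have e : mono (5 * (k - s%:Z)) (2 * (k - s%:Z) * (k - s%:Z) + (k - s%:Z)
       + 3 * d%:Z * (k - s%:Z) + (tri (k - s%:Z))%:Z)
     * (x ^+ s / q ^+ 'C(s.+1, 2)) * (mono 2 (2 * (k - s%:Z) + d%:Z) ^+ s * q ^+ (s * s)) =
   mono (5 * k) (2 * k * k + k + 3 * d%:Z * k + (tri k)%:Z)
     * (mono (-1) (- k) ^+ s * q ^+ (s * (s - d))).
  rewrite /x !monoX !monoq !monoV !monoM; congr mono; first by lia.
  have := tri_mul2 k; have := tri_mul2 (k - s%:Z); have := bin2_mul2 s.+1 => /=.
  (* Truncation in s - d is harmless: for d <= 1 it only occurs at s = 0, where the product
     vanishes. *)
  have : (s * (s - d))%N%:Z = s%:Z * s%:Z - d%:Z * s%:Z.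
    by move: d_le1; case: (d) => [|[|//]] _; case: (s) => [|s'] /=; nia.
  by nia.
(* The sign (-1)^s from [signB] cancels the one from (-x)^s. *)
have gen (sg sk m1 xs qc m2 qs : C) : sg * sg = 1 ->
    sk * sg * m1 * H * (sg * xs / qc * Q * P * D * (m2 * qs)) =
    sk * (m1 * (xs / qc) * (m2 * qs)) * P * (H * Q * D).
  by move=> sg1; rewrite -[RHS]mul1r -sg1; ring.
rewrite (exprNn x) gen; last by rewrite -exprMn mulrNN mulr1 expr1n.
by rewrite e; ring.
Qed.

Hypothesis h_growth : exists H E : C,
  [/\ 0 <= H, 0 <= E & forall k : int, `|h (mono (-1) k)| <= H * E ^+ `|k|%N].

(** The quadratic exponent splits into tri r and C(s,2), which give Gaussian decay in r and in s,
    and tri (2 r + s), which is the weight that [qpoch_inf_shift_le] requires. *)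
Let T_factor (r : int) (s : nat) :
  T r s = (-1) ^ r * (mono 5 (2 + 3 * d%:Z) ^ r * h (mono (-1) (- r)) * q ^+ tri r) *
    (mono 2 (d%:Z + 1) ^+ s * q ^+ 'C(s, 2)) *
    ((qfac q q s)^-1 * (qpoch_inf (mono 2 (d%:Z + 1) * q ^ (2 * r + s%:Z)) q
                        * q ^+ tri (2 * r + s%:Z))).
Proof.
rewrite /T /alpha /alpha0.
have -> : mono 2 (2 * r + d%:Z) * q ^+ s.+1 = mono 2 (d%:Z + 1) * q ^ (2 * r + s%:Z).
  by rewrite monoq [q ^ (_ + _)]monoqz !monoM; congr mono; clear; lia.
have e : mono (5 * r) (2 * r * r + r + 3 * d%:Z * r + (tri r)%:Z) *
    (mono 2 (2 * r + d%:Z) ^+ s * q ^+ (s * s)) =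
    mono 5 (2 + 3 * d%:Z) ^ r * q ^+ tri r * (mono 2 (d%:Z + 1) ^+ s * q ^+ 'C(s, 2))
      * q ^+ tri (2 * r + s%:Z).
  rewrite monoZ !monoX !monoq !monoM; congr mono; first by clear; lia.
  have := tri_mul2 r; have := tri_mul2 (2 * r + s%:Z); have := tri_mul2 s%:Z => /=.
  by clear; nia.
set P := qpoch_inf _ q; set m := tri (2 * r + _) in e *.
set w := mono 5 _ ^ r in e *; set xs := mono 2 (_ + 1) ^+ s in e *.
rewrite [RHS](_ : _ = (-1) ^ r * h (mono (-1) (- r)) * (qfac q q s)^-1 * P
   * (w * q ^+ tri r * (xs * q ^+ 'C(s, 2)) * q ^+ m)); last by ring.
by rewrite -e; ring.
Qed.

Let T_dominated : exists M : C, forall r s,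
  `|T r s| <= M * (2^-1 ^+ 2) ^+ (`|r| + s)%N.
Proof.
have [H [E [H0 E0 hE]]] := h_growth.
have [Ki Ki0 hKi] := qfac_inv_bounded geoC q_lt1.
pose x := mono 2 (d%:Z + 1).
have [K K0 hK] := qpoch_inf_shift_le geoC q_lt1 q_neq0 (mono_neq0 2 (d%:Z + 1)).
pose w := mono 5 (2 + 3 * d%:Z); pose B := `|w| + `|w|^-1.
pose D := 1 + `|x|.
have abs_le (r : int) (s : nat) : (`|(2 * r + s%:Z)%R| <= 2 * `|r| + s)%N by clear; lia.
have B0 : 0 <= B by rewrite addr_ge0 ?invr_ge0.
have D0 : 0 <= D by rewrite addr_ge0.
have D1 : 1 <= D by rewrite lerDl.
(* The Gaussian factor in r absorbs all exponential growth in |r|: B from the power of [w], E from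
   h, D^2 from |2 r + s| <= 2 |r| + s. The one in s absorbs |x| and the remaining D. *)
have [M1 M10 hM1] := gaussian_le geoC q_lt1 (mulr_ge0 (mulr_ge0 B0 E0) (exprn_ge0 2 D0)).
have [M2 M20 hM2] := gaussian_le geoC q_lt1 (mulr_ge0 (normr_ge0 x) D0).
exists (H * Ki * K * M1 * M2) => r s.
pose m := 2 * r + s%:Z.
rewrite T_factor -/x -/w -/m.
have n1 : `|(-1) ^ r| = 1 :> C.
  by case: (r) => n; rewrite ?NegzE -?exprnN -?exprnP ?normfV normrX normrN1 expr1n ?invr1.
have hP := hK m; rewrite -/x -/D in hP.
have mle : D ^+ `|m|%N <= (D ^+ 2) ^+ `|r|%N * D ^+ s.
  by rewrite -exprM -exprD; apply: ler_weXn2l (abs_le r s).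
have tle : `|q| ^+ tri r <= `|q| ^+ 'C(`|r|%N, 2).
  by apply: ler_wiXn2l (bin2_le_tri r) => //; exact: ltW.
rewrite !normrM n1 mul1r ![`|q ^+ _|]normrX [`|x ^+ s|]normrX.
apply: (@le_trans _ _ ((B ^+ `|r|%N * (H * E ^+ `|r|%N) * `|q| ^+ 'C(`|r|%N, 2)) *
   (`|x| ^+ s * `|q| ^+ 'C(s, 2)) * (Ki * (K * ((D ^+ 2) ^+ `|r|%N * D ^+ s))))).
  apply: ler_pM; rewrite ?mulr_ge0 ?exprn_ge0 //.
    apply: ler_wpM2r; rewrite ?mulr_ge0 ?exprn_ge0 //.
    apply: ler_pM; rewrite ?mulr_ge0 ?exprn_ge0 //.
    apply: ler_pM; rewrite ?mulr_ge0 ?exprn_ge0 ?norm_exprz_le //.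
    by have := hE (- r); rewrite abszN.
  apply: ler_pM; rewrite ?mulr_ge0 ?exprn_ge0 //.
  by apply: le_trans hP _; apply: ler_wpM2l.
rewrite [leLHS](_ : _ = H * Ki * K *
  ((`|q| ^+ 'C(`|r|%N, 2) * (B * E * D ^+ 2) ^+ `|r|%N) *
   (`|q| ^+ 'C(s, 2) * (`|x| * D) ^+ s))); last by rewrite !exprMn; ring.
rewrite exprD [leRHS](_ : _ = H * Ki * K *
  ((M1 * (2^-1 ^+ 2) ^+ `|r|%N) * (M2 * (2^-1 ^+ 2) ^+ s))); last by ring.
apply: ler_wpM2l; rewrite ?mulr_ge0 //.
by apply: ler_pM; rewrite ?hM1 ?hM2 // mulr_ge0 ?exprn_ge0 ?mulr_ge0 ?exprn_ge0.
Qed.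

(** [bilateral_sum_exchange] applied to [c * T]: the rows sum to [c * alpha r] by Cauchy's sum, the
    diagonals to the original terms by the well-poised sum. *)
Theorem bilateral_sum_transform (L : C) :
  (forall k : int, qpoch (z * q) q k != 0) -> theta q (z ^- 2 / q ^+ d) != 0 ->
  bilateral_sum_to
    (fun r : int => (-1) ^ r * (z ^ (5 * r) * q ^ (2 * r * r + r + 3 * d%:Z * r + (tri r)%:Z))
         * h (z ^ (-1) * q ^ (- r))) L ->
  bilateral_sum_to
    (fun k : int => q ^ (k * k + d%:Z * k) / qpoch (z * q) q k * z ^ (2 * k))
    (qpoch_inf z^-1 q / theta q (z ^- 2 / q ^+ d) * L).
Proof.
move=> den th0 hL.
pose c := qpoch_inf z^-1 q / theta q (z ^- 2 / q ^+ d).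
have [M hM] := T_dominated.
have l0 : 0 <= (2^-1 : C) by rewrite invr_ge0.
have l1 : (2^-1 : C) < 1 by rewrite invf_lt1 ?ltr1n.
have cT k s : `|c * T k s| <= `|c| * M * (2^-1 ^+ 2) ^+ (`|k| + s)%N.
  by rewrite normrM -mulrA ler_wpM2l.
apply: (bilateral_sum_exchange geoC l0 l1 cT (A := fun r => c * alpha r)).
- by move=> k; apply: cvg_seriesZ; exact: T_row.
- move=> k; pose Y := mono (-1) (- k).
  have [l hl lP] := h_sum Y.
  pose V := Y ^+ 2 / q ^+ d.
  suff -> : q ^ (k * k + d%:Z * k) / qpoch (z * q) q k * z ^ (2 * k) =
      c * (alpha0 k * qpoch_inf (mono 2 (2 * k + d%:Z + 1)) q) * l.
    apply: (eq_cvgn _ (cvg_seriesZ hl)) => n; congr (series _ n).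
    by apply/funext => s; rewrite T_diag mulrA.
  have VE : V = mono (-2) (-2 * k - d%:Z).
    by rewrite /V /Y monoX monoq monoV monoM; congr mono; lia.
  (* The product left over in [T_diag] and the right-hand side of the well-poised sum have arguments
     q/V and V. Their theta function is then shifted by -2k to one independent of k. *)
  have thV : qpoch_inf (mono 2 (2 * k + d%:Z + 1)) q * qpoch_inf V q = theta q V.
    rewrite mulrC /theta; congr (_ * qpoch_inf _ q).
    by rewrite VE -[q in RHS]expr1 monoq monoV monoM; congr mono; lia.
  have W0 : z ^- 2 / q ^+ d = mono (-2) (- d%:Z).
    by rewrite /mono -!exprnN.
  have thW : theta q (z ^- 2 / q ^+ d) =
      mono (4 * k) (2 * d%:Z * k + (tri (-2 * k))%:Z) * theta q V.
    rewrite (theta_shift geoC q_lt1 q_neq0 (-2 * k)); last by rewrite W0 mono_neq0.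
    rewrite W0; congr (_ * theta q _).
      rewrite monoq (_ : -2 * k = 2 * - k) -?exprz_exp; last by lia.
      rewrite -[(- _) ^ 2]exprnP sqrrN exprnP exprz_exp monoZ monoM.
      by congr mono; lia.
    by rewrite VE monoqz monoM; congr mono; lia.
  have refl := qpoch_inf_reflect z_neq0 (den k).
  have YE : z^-1 * q ^ (- k) = Y by rewrite /Y /mono exprN1.
  rewrite YE in refl.
  have sgn : (-1) ^ k * (-1) ^ k = 1 :> C by rewrite -expfzMl mulrNN mulr1 exp1rz.
  have mE : q ^ (k * k + d%:Z * k) * z ^ (2 * k) *
      mono (4 * k) (2 * d%:Z * k + (tri (-2 * k))%:Z) =
      (- z) ^ k * q ^+ tri (k + 1) * alpha0 k.
    rewrite -(mulN1r z) expfzMl /alpha0 monoq.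
    rewrite [RHS](_ : _ = (-1) ^ k * (-1) ^ k * (mono k 0 * mono 0 (tri (k + 1))%:Z *
      mono (5 * k) (2 * k * k + k + 3 * d%:Z * k + (tri k)%:Z))); last first.
      by rewrite (_ : mono k 0 = z ^ k); [ring | rewrite /mono expr0z mulr1].
    rewrite sgn mul1r [q ^ _ * z ^ _]mulrC -/(mono _ _) !monoM; congr mono; first by lia.
    have := tri_mul2 k; have := tri_mul2 (k + 1); have := tri_mul2 (-2 * k).
    by nia.
  have tW0 := th0; rewrite thW mulf_eq0 negb_or in tW0; case/andP: tW0 => m0 tV0.
  rewrite /c thW.
  set p := qpoch (z * q) q k in refl *.
  have p0 : p != 0 by exact: den.
  set P1 := qpoch_inf (mono 2 _) q in thV *.
  set m := mono (4 * k) _ in m0 mE *; set tV := theta q V in thV tV0 *.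
  set a := alpha0 k in mE *; set y := qpoch_inf z^-1 q in refl *.
  set X := q ^ _ in mE *; set Z := z ^ _ in mE *.
  (* With denominators cleared, the two sides agree by the reflection, the exponent identity [mE],
     [thV] and the well-poised sum [lP]. *)
  apply: (mulIf (mulf_neq0 p0 (mulf_neq0 m0 tV0))).
  rewrite [LHS](_ : _ = X * Z * m * tV); last by field.
  rewrite [RHS](_ : _ = p * y * a * P1 * l); last by field; rewrite m0 tV0.
  rewrite -refl mE -thV -[qpoch_inf V q]lP; ring.
- exact: bilateral_sumZ.
Qed.


End Core.
End BilateralRogersRamanujan.

(** * Geometric completeness of the complex numbers *)

Lemma near_dist_cvgn (C : numFieldType) (u : nat -> C) (l : C) :
  (forall e : C, 0 < e -> \forall n \near \oo, `|l - u n| < e) -> cvgn u.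
Proof. by move=> h; apply/cvg_ex; exists l; exact/cvgrPdist_lt. Qed.

(** Being nonnegative, M and r are real. The real and imaginary parts thus converge absolutely by
    comparison with a real geometric series, and |a + i b| <= |a| + |b| joins the two limits. *)
Lemma complex_geometrically_complete (R : realType) : geometrically_complete R[i].
Proof.
move=> u M r r0 r1 uM.
have rI : r = (complex.Re r)%:C%C by rewrite RRe_real // ger0_real.
have M0 : 0 <= M by have := uM 0%N; rewrite expr0 mulr1; exact: le_trans.
have MI : M = (complex.Re M)%:C%C by rewrite RRe_real // ger0_real.
set r' := complex.Re r in rI; set M' := complex.Re M in MI.
have r0' : 0 <= r' by move: r0; rewrite rI lecR.
have r1' : r' < 1 by move: r1; rewrite rI ltcR.
have part (f : R[i] -> R) : (forall x, (`|f x|)%:C%C <= `|x|) ->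
    cvgn (series (fun n => f (u n))).
  move=> fx; apply: normed_cvg.
  apply: (@series_le_cvg _ _ (geometric M' r')) => [n|n|n|].
  - exact: normr_ge0.
  - by rewrite /geometric /= mulr_ge0 ?exprn_ge0 // -lecR -MI.
  - have := le_trans (fx _) (uM n).
    by rewrite rI MI -rmorphXn -rmorphM lecR.
  - by apply: is_cvg_geometric_series; rewrite ger0_norm.
have /cvg_ex[/= a /cvgrPdist_lt ha] := part (@complex.Re R) (@normc_ge_Re R).
have /cvg_ex[/= b /cvgrPdist_lt hb] : cvgn (series (fun n => complex.Im (u n))).
  apply: part => x; rewrite normc_def lecR -sqrtr_sqr ler_wsqrtr //.
  by rewrite lerDr sqr_ge0.
have partE n : series u n = (series (fun n => complex.Re (u n)) n
    +i* series (fun n => complex.Im (u n)) n)%C.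
  elim: n => [|n IH]; first by rewrite /series /= !big_nil.
  rewrite /series /= in IH *; rewrite !big_nat_recr //= IH.
  by case: (u n).
apply: (@near_dist_cvgn R[i] _ (a +i* b)%C) => e e0.
have eI : e = (complex.Re e)%:C%C by rewrite RRe_real // ger0_real // ltW.
set e' := complex.Re e in eI.
have e0' : 0 < e' / 2 by rewrite divr_gt0 //; move: e0; rewrite eI ltcR.
near=> n; rewrite partE.
have h1 : `|a - series (fun n => complex.Re (u n)) n| < e' / 2.
  by near: n; exact: ha.
have h2 : `|b - series (fun n => complex.Im (u n)) n| < e' / 2.
  by near: n; exact: hb.
have -> (x y x' y' : R) :
    (x +i* y)%C - (x' +i* y')%C = ((x - x') +i* (y - y'))%C by [].
rewrite [X in `|X|]complexE /=.
apply: le_lt_trans (ler_normD _ _) _; rewrite normrM.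
have nR (x : R) : `|x%:C%C| = `|x|%:C%C by rewrite normc_def /= expr0n addr0 sqrtr_sqr.
have -> : `|'i%C| = 1 :> R[i] by rewrite normc_def /= expr0n add0r expr1n sqrtr1.
rewrite mul1r !nR eI -rmorphD ltcR.
by rewrite [ltRHS](_ : e' = e' / 2 + e' / 2) ?ltrD //; field.
Unshelve. all: by end_near.
Qed.

(** * Evaluation by theta functions in base q^5 *)

Lemma qpochs_inf2 (C : numFieldType) (a b q : C) :
  qpochs_inf [:: a; b] q = qpoch_inf a q * qpoch_inf b q.
Proof. by rewrite /qpochs_inf !big_cons big_nil mulr1. Qed.

Lemma qpochs_inf_theta (C : numFieldType) (q x : C) (m n : nat) : q != 0 ->
  qpochs_inf [:: x * q ^+ m; x^-1 * q ^+ n] (q ^+ (m + n)) =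
  theta (q ^+ (m + n)) (x * q ^+ m).
Proof.
move=> q0; rewrite qpochs_inf2 /theta; congr (_ * qpoch_inf _ _).
by rewrite exprD invfM mulrCA mulrAC mulfV ?mul1r // expf_neq0.
Qed.

Section Main.
Variable C : numFieldType.
Hypothesis geoC : geometrically_complete C.
Variables q z : C.
Hypotheses (q_lt1 : `|q| < 1) (q_neq0 : q != 0) (z_neq0 : z != 0).
Hypothesis den : forall k : int, qpoch (z * q) q k != 0.
Hypothesis den' : theta q (z ^- 2) != 0.

Let q5_lt1 : `|q ^+ 5| < 1. Proof. by rewrite normrX exprn_ilt1. Qed.
Let q5_neq0 : q ^+ 5 != 0. Proof. by rewrite expf_neq0. Qed.

(** Jacobi's triple product in base q^5 at z^5 q^j. *)
Let triple (j : nat) : bilateral_sum_to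
    (fun r : int => (-1) ^ r * (z ^ (5 * r) * q ^ (5 * (tri r)%:Z + j%:Z * r)))
    (qpoch_inf (q ^+ 5) (q ^+ 5) * theta (q ^+ 5) (z ^+ 5 * q ^+ j)).
Proof.
have x0 : z ^+ 5 * q ^+ j != 0 by rewrite mulf_neq0 ?expf_neq0.
apply: eq_bilateral_sum (jacobi_triple_product geoC q5_lt1 q5_neq0 x0) => k.
have e (y : C) (n : nat) : (y ^+ n) ^ k = y ^ (n%:Z * k) by rewrite exprnP exprz_exp.
rewrite -(mulN1r (z ^+ 5 * _)) (expfzMl (-1)) (expfzMl (z ^+ 5)) !e -!mulrA; congr (_ * (_ * _)).
by rewrite -exprM exprnP -expfzDr //; congr (q ^ _); clear; lia.
Qed.

(** Covers both choices of h: w = q for d = 0 and w = q^2 for d = 1. *)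
Let growth (x w : C) : exists H E : C, [/\ 0 <= H, 0 <= E &
  forall k : int, `|1 + x * w ^ k| <= H * E ^+ `|k|%N].
Proof.
exists (1 + `|x|), (1 + (`|w| + `|w|^-1)).
have w0 : 0 <= `|w| + `|w|^-1 by rewrite addr_ge0 ?invr_ge0.
split; rewrite ?addr_ge0 // => k.
have E1 : 1 <= (1 + (`|w| + `|w|^-1)) ^+ `|k|%N by rewrite exprn_ege1 // lerDl.
apply: le_trans (ler_normD _ _) _; rewrite normr1 mulrDl mul1r.
apply: lerD => //; rewrite normrM ler_wpM2l //.
apply: le_trans (norm_exprz_le _ _) _.
by apply: lerXn2r; rewrite ?nnegrE ?addr_ge0 // lerDr.
Qed.

(** Since (5 r^2 + r)/2 = 5 tri r + 3 r, the term 1 of h gives [triple 3]; the term q^(-r)/z lowers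
    3 to 2 and contributes 1/z. *)
Lemma bilateral_rogers_ramanujan1 : bilateral_sum_to
  (fun k : int => q ^ (k ^+ 2) / qpoch (z * q) q k * z ^ (2 * k))
  (qpoch_inf z^-1 q / theta q (z ^- 2) * qpoch_inf (q ^+ 5) (q ^+ 5) *
   (theta (q ^+ 5) (z ^+ 5 * q ^+ 3) + z^-1 * theta (q ^+ 5) (z ^+ 5 * q ^+ 2))).
Proof.
have hsum (Y : C) : exists2 l : C,
    series (fun s => (1 + Y * q ^+ s) * qfac (Y ^+ 2 / q ^+ 0) q s / qfac q q s
                   * (Y ^+ s * q ^+ (s * (s - 0)))) @ \oo --> l &
    l * qpoch_inf Y q = qpoch_inf (Y ^+ 2 / q ^+ 0) q.
  have [l hl lP] := sum_well_poised0 geoC q_lt1 Y.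
  exists l; last by rewrite expr0 divr1.
  by apply: (eq_cvgn _ hl) => n; apply: eq_bigr => s _; rewrite expr0 divr1 subn0.
have hL := bilateral_sumD (triple 3) (bilateral_sumZ z^-1 (triple 2)).
have h := @bilateral_sum_transform C geoC q q_lt1 q_neq0 z 0 (fun Y => 1 + Y) z_neq0 isT
  hsum (growth _ _) _ den.
rewrite expr0 divr1 in h.
have {h}h := h _ den' (eq_bilateral_sum _ hL).
rewrite [X in bilateral_sum_to _ X](_ : _ = qpoch_inf z^-1 q / theta q (z ^- 2) *
  (qpoch_inf (q ^+ 5) (q ^+ 5) * theta (q ^+ 5) (z ^+ 5 * q ^+ 3) +
   z^-1 * (qpoch_inf (q ^+ 5) (q ^+ 5) * theta (q ^+ 5) (z ^+ 5 * q ^+ 2)))); last by ring.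
apply: eq_bilateral_sum (h _) => k; first by rewrite mul0r addr0 expr2.
rewrite mulrDr mulr1; congr (_ + _).
  by congr (_ * (_ * q ^ _)); have := tri_mul2 k; clear; nia.
rewrite exprN1 mulrCA -[in RHS]mulrA; congr (_ * _).
rewrite [RHS]mulrCA; congr (_ * _); rewrite [RHS]mulrAC -mulrA -expfzDr //.
by congr (_ * q ^ _); have := tri_mul2 k; clear; nia.
Qed.

(** The exponent is now 5 tri r + 6 r, so h gives [triple 6] and, through q^(-2 r), [triple 4]. One
    step of [thetaS] takes z^5 q^6 back to z^5 q, another takes z^(-2)/q to z^(-2) in the
    denominator; the quotient of their factors is z^(-3). *)
Lemma bilateral_rogers_ramanujan2 : bilateral_sum_to
  (fun k : int => q ^ (k * (k + 1)) / qpoch (z * q) q k * z ^ (2 * k))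
  (qpoch_inf z^-1 q / theta q (z ^- 2) * qpoch_inf (q ^+ 5) (q ^+ 5) *
   (theta (q ^+ 5) (z ^+ 5 * q ^+ 4) + z ^- 3 * theta (q ^+ 5) (z ^+ 5 * q))).
Proof.
have hsum (Y : C) : exists2 l : C,
    series (fun s => (1 - (Y * q ^+ s) ^+ 2 / q) * qfac (Y ^+ 2 / q ^+ 1) q s / qfac q q s
                   * (Y ^+ s * q ^+ (s * (s - 1)))) @ \oo --> l &
    l * qpoch_inf Y q = qpoch_inf (Y ^+ 2 / q ^+ 1) q.
  have [l hl lP] := sum_well_poised1 geoC q_lt1 Y q_neq0.
  exists l => //; apply: (eq_cvgn _ hl) => n; apply: eq_bigr => s _.
  have -> : (Y * q ^+ s) ^+ 2 / q = Y ^+ 2 / q * q ^+ (s + s).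
    by rewrite exprMn -exprM muln2 -addnn mulrAC.
  by rewrite expr1 subn1.
have hgrow : exists H E : C, [/\ 0 <= H, 0 <= E &
    forall k : int, `|1 - (z ^ (-1) * q ^ k) ^+ 2 / q| <= H * E ^+ `|k|%N].
  have [H [E [H0 E0 hE]]] := growth (- (z ^- 2 / q)) (q ^+ 2).
  exists H, E; split => // k.
  rewrite (_ : 1 - _ = 1 + - (z ^- 2 / q) * (q ^+ 2) ^ k) //.
  rewrite exprN1 exprMn exprVn mulNr mulrAC; congr (1 - _ * _).
  by rewrite !exprnP !exprz_exp mulrC.
have q6 : z ^+ 5 * q * q ^+ 5 = z ^+ 5 * q ^+ 6 by rewrite -mulrA -exprS.
have th6 : theta (q ^+ 5) (z ^+ 5 * q) =
    - (z ^+ 5 * q) * theta (q ^+ 5) (z ^+ 5 * q ^+ 6).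
  by rewrite -q6; apply: thetaS => //; rewrite mulf_neq0 ?expf_neq0.
have z20 : z ^- 2 / q != 0 by rewrite mulf_neq0 ?invr_eq0 ?expf_neq0.
have th2 : theta q (z ^- 2 / q) = - (z ^- 2 / q) * theta q (z ^- 2).
  by rewrite (thetaS geoC q_lt1 q_neq0 z20) divfK.
have th20 : theta q (z ^- 2 / q ^+ 1) != 0.
  by rewrite expr1 th2 mulf_neq0 // oppr_eq0.
have hL := bilateral_sumD (triple 6) (bilateral_sumZ (- (z ^- 2 / q)) (triple 4)).
have h := @bilateral_sum_transform C geoC q q_lt1 q_neq0 z 1 (fun Y => 1 - Y ^+ 2 / q)
  z_neq0 isT hsum hgrow _ den th20 (eq_bilateral_sum _ hL).
rewrite [X in bilateral_sum_to _ X](_ : _ = qpoch_inf z^-1 q / theta q (z ^- 2 / q ^+ 1) *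
  (qpoch_inf (q ^+ 5) (q ^+ 5) * theta (q ^+ 5) (z ^+ 5 * q ^+ 6) +
   - (z ^- 2 / q) * (qpoch_inf (q ^+ 5) (q ^+ 5) * theta (q ^+ 5) (z ^+ 5 * q ^+ 4)))).
  apply: eq_bilateral_sum (h _) => k.
    by congr (q ^ _ / _ * _); clear; lia.
  rewrite mulrBr mulr1 [in RHS]exprMn; congr (_ + _).
    by congr (_ * (_ * q ^ _)); have := tri_mul2 k; clear; nia.
  rewrite mulNr; congr (- _).
  have -> : (z ^ (-1)) ^+ 2 * (q ^ (- k)) ^+ 2 / q = z ^- 2 / q * q ^ (- k * 2).
    by rewrite exprN1 exprVn [(q ^ (- k)) ^+ 2]exprnP exprz_exp mulrAC.
  set c := z ^- 2 / q; set sg := (-1) ^ k; set zk := z ^ _.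
  rewrite [RHS](_ : _ = c * (sg * (zk * (q ^ (2 * k * k + k + 3 * 1%:Z * k + (tri k)%:Z)
    * q ^ (- k * 2))))); last by ring.
  rewrite -expfzDr //; congr (_ * (_ * (_ * q ^ _))).
  by have := tri_mul2 k; clear; nia.
rewrite expr1 th2 th6; set t := theta q _; have t0 : t != 0 by exact: den'.
set a := theta _ _; set b := theta _ _.
by field; rewrite t0 q_neq0 z_neq0.
Qed.

End Main.

Theorem theorem2p1 (R : realType) (q z : R[i])
    (q_neq0 : q != 0) (q_lt1 : `|q| < 1) (z_neq0 : z != 0)
    (den_lhs : forall k : int, qpoch (z * q) q k != 0)
    (den_rhs : qpochs_inf [:: 1 / z ^+ 2; z ^+ 2 * q] q != 0) :
  bilateral_sum_to
    (fun k : int => q ^ (k ^+ 2) / qpoch (z * q) q k * z ^ (2 * k))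
    (qpoch_inf (1 / z) q / qpochs_inf [:: 1 / z ^+ 2; z ^+ 2 * q] q
     * qpoch_inf (q ^+ 5) (q ^+ 5)
     * (qpochs_inf [:: z ^+ 5 * q ^+ 3; z ^- 5 * q ^+ 2] (q ^+ 5)
        + z^-1 * qpochs_inf [:: z ^+ 5 * q ^+ 2; z ^- 5 * q ^+ 3] (q ^+ 5)))
  /\
  bilateral_sum_to
    (fun k : int => q ^ (k * (k + 1)) / qpoch (z * q) q k * z ^ (2 * k))
    (qpoch_inf (1 / z) q / qpochs_inf [:: 1 / z ^+ 2; z ^+ 2 * q] q
     * qpoch_inf (q ^+ 5) (q ^+ 5)
     * (qpochs_inf [:: z ^+ 5 * q ^+ 4; z ^- 5 * q] (q ^+ 5)
        + z ^- 3 * qpochs_inf [:: z ^+ 5 * q; z ^- 5 * q ^+ 4] (q ^+ 5))).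
Proof.
have geoC := @complex_geometrically_complete R.
have dE : qpochs_inf [:: 1 / z ^+ 2; z ^+ 2 * q] q = theta q (z ^- 2).
  by rewrite qpochs_inf2 /theta div1r invrK [q * _]mulrC.
rewrite dE in den_rhs *.
rewrite (qpochs_inf_theta (z ^+ 5) 3 2 q_neq0) (qpochs_inf_theta (z ^+ 5) 2 3 q_neq0).
rewrite (qpochs_inf_theta (z ^+ 5) 4 1 q_neq0) (qpochs_inf_theta (z ^+ 5) 1 4 q_neq0) div1r.
split; [exact: bilateral_rogers_ramanujan1 | exact: bilateral_rogers_ramanujan2].
Qed.
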